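(* Let $V\in C^2(\mathbb R^d)$ be real-valued with $\int_{\mathbb R^d}e^{-V(x)}\,dx=1$. For $x\in\mathbb R^d$ let $B_x^1$ be the Euclidean ball of radius $1$ centered at $x$, let $m$ denote Lebesgue measure, and set $$W(x):=e^{-V(x)},\qquad W_+(x):=W(x)+\frac1{m(B_x^1)}\int_{B_x^1}W(y)\,dy .$$ Suppose there are $s\in(0,1)$, $\rho>0$ and $R$ such that $$s|\nabla V(x)|^2-\Delta V(x)\ge\rho\quad\text{whenever }|x|>R .$$ Then for any fixed $p\in[1,\infty)$ there is a finite constant $C$ such that $$\int_{\mathbb R^d}|f(x)|^pW_+(x)\,dx\le C\int_{\mathbb R^d}\left[\int_{B_x^1}|f(x)-f(y)|^p\,dy\right]W(x)\,dx$$ for all measurable $f$ on $\mathbb R^d$ with $\int_{\mathbb R^d} fW\,dx=0$. The constant $C$ does not depend on $f$.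
   Context: The condition $\int fW\,dx=0$ includes that $fW$ is integrable. *)

(* Defs.v *)
From HB Require Import structures.
From mathcomp Require Import all_boot all_order all_algebra.
From mathcomp Require Import all_classical all_reals all_analysis.

Set Implicit Arguments.
Unset Strict Implicit.
Unset Printing Implicit Defensive.

Import Order.TTheory GRing.Theory Num.Theory.
Import numFieldNormedType.Exports.

Local Open Scope classical_set_scope.
Local Open Scope ring_scope.

(* R^d is 'rV[R]_d.  Lebesgue measure on it is built in two steps: the d-fold
   product measure on the Borel sigma-algebra, then its completion. *)

Section borel_rV.
Variables (R : realType) (d : nat).

(* Preimages of Borel sets of R under the coordinate maps. *)
Definition borel_rV_gen : set (set 'rV[R]_d) :=
  [set (fun x : 'rV[R]_d => x ord0 i) @^-1` B | i in [set: 'I_d] & B in measurable].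

Definition borel_rV := g_sigma_algebraType borel_rV_gen.

Lemma measurable_borel_rV_coord (i : 'I_d) :
  measurable_fun [set: borel_rV] (fun x : borel_rV => (x : 'rV[R]_d) ord0 i).
Proof.
by move=> _ B mB; rewrite setTI; apply: sub_sigma_algebra; exists i => //; exists B.
Qed.

Lemma measurable_fun_borel_rVP (e : measure_display) (T : measurableType e)
    (f : T -> borel_rV) :
  (forall i, measurable_fun [set: T] (fun t => (f t : 'rV[R]_d) ord0 i)) ->
  measurable_fun [set: T] f.
Proof.
move=> mf; apply: (@measurability _ _ T borel_rV setT f borel_rV_gen) => //.
by move=> _ [_ [i _ [B mB <-]] <-]; exact: mf.
Qed.

End borel_rV.

Section cons_rV.
Variables (R : realType) (d : nat).

Definition cons_rV (z : measurableTypeR R * borel_rV R d) : borel_rV R d.+1 :=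
  (row_mx (z.1%:M : 'rV[R]_1) (z.2 : 'rV[R]_d) : 'rV[R]_(1 + d)).

Definition uncons_rV (x : borel_rV R d.+1) : measurableTypeR R * borel_rV R d :=
  let x' := (x : 'rV[R]_(1 + d)) in (lsubmx x' ord0 ord0, rsubmx x').

Lemma cons_rVK : cancel cons_rV uncons_rV.
Proof.
move=> [a x]; rewrite /uncons_rV /cons_rV row_mxKl row_mxKr /=.
by rewrite mxE eqxx mulr1n.
Qed.

Lemma uncons_rVK : cancel uncons_rV cons_rV.
Proof.
move=> x; rewrite /uncons_rV /cons_rV /=; set x' : 'rV[R]_(1 + d) := x.
have -> : (lsubmx x' ord0 ord0)%:M = lsubmx x'.
  by apply/matrixP => i j; rewrite (ord1 i) (ord1 j) [LHS]mxE eqxx mulr1n.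
exact: (@hsubmxK _ 1 1 d).
Qed.

Lemma measurable_cons_rV : measurable_fun setT cons_rV.
Proof.
apply: measurable_fun_borel_rVP => i.
case: (split_ordP (i : 'I_(1 + d))) => j ->.
  apply: (eq_measurable_fun fst) => // z _.
  apply/esym/(etrans (row_mxEl _ _ _ _)).
  by rewrite (ord1 j) mxE eqxx mulr1n.
apply: (eq_measurable_fun
  ((fun x : borel_rV R d => (x : 'rV[R]_d) ord0 j) \o snd)) => [z _|].
  exact/esym/row_mxEr.
by apply: measurableT_comp => //; exact: measurable_borel_rV_coord.
Qed.

Lemma measurable_uncons_rV : measurable_fun setT uncons_rV.
Proof.
apply/measurable_fun_pairP; split.
  apply: (eq_measurable_fun
    (fun x : borel_rV R d.+1 => (x : 'rV[R]_d.+1) ord0 (lshift d (ord0 : 'I_1)))).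
    by move=> x _ /=; rewrite mxE.
  exact: measurable_borel_rV_coord.
apply: measurable_fun_borel_rVP => i.
apply: (eq_measurable_fun
  (fun x : borel_rV R d.+1 => (x : 'rV[R]_d.+1) ord0 (rshift 1 i))).
  by move=> x _ /=; rewrite mxE.
exact: measurable_borel_rV_coord.
Qed.

End cons_rV.

Section cons_measure.
Variables (R : realType) (d : nat).
Variable m : {sigma_finite_measure set (borel_rV R d) -> \bar R}.
Local Open Scope ereal_scope.

Definition cons_measure : set (borel_rV R d.+1) -> \bar R :=
  pushforward (@lebesgue_measure R \x m) (@cons_rV R d).

Let cons_measure0 : cons_measure set0 = 0.
Proof. by rewrite /cons_measure /pushforward preimage_set0 measure0. Qed.

Let cons_measure_ge0 A : 0 <= cons_measure A.
Proof. exact: (measure_ge0 (@lebesgue_measure R \x m)). Qed.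

Let cons_measure_sigma_additive : semi_sigma_additive cons_measure.
Proof.
move=> F mF tF mUF; rewrite /cons_measure /pushforward preimage_bigcup.
have mcons A : measurable A -> measurable (@cons_rV R d @^-1` A).
  by move=> mA; rewrite -[X in measurable X]setTI; exact: measurable_cons_rV.
apply: (measure_semi_sigma_additive (s := @lebesgue_measure R \x m)).
- by move=> n; exact: mcons.
- apply/trivIsetP => i j _ _ ij; rewrite -preimage_setI.
  by move/trivIsetP : tF => /(_ _ _ Logic.I Logic.I ij) ->; rewrite preimage_set0.
- by rewrite -preimage_bigcup; exact: mcons.
Qed.

HB.instance Definition _ := isMeasure.Build _ _ _ cons_measure
  cons_measure0 cons_measure_ge0 cons_measure_sigma_additive.

Let cons_measure_sigma_finite : sigma_finite setT cons_measure.
Proof.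
have /sigma_finiteP[F [FT ndF Foo]] := sigma_finiteT (@lebesgue_measure R).
have /sigma_finiteP[G [GT ndG Goo]] := sigma_finiteT m.
exists (fun n => @uncons_rV R d @^-1` (F n `*` G n)).
  rewrite -preimage_bigcup (_ : \bigcup_n _ = setT) ?preimage_setT//.
  apply/seteqP; split => // -[a x] _.
  have [i _ Fia] : (\bigcup_i F i) a by rewrite -FT.
  have [k _ Gkx] : (\bigcup_k G k) x by rewrite -GT.
  exists (maxn i k) => //; split => /=.
    by move: a Fia; exact/subsetPset/ndF/leq_maxl.
  by move: x Gkx; exact/subsetPset/ndG/leq_maxr.
move=> n; have [mFn Fnoo] := Foo n; have [mGn Gnoo] := Goo n; split.
  rewrite -[X in measurable X]setTI; apply: measurable_uncons_rV => //.
  exact: measurableX.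
rewrite /cons_measure /pushforward -comp_preimage.
rewrite (_ : _ \o _ = id); last by apply/funext => z; exact: cons_rVK.
by rewrite preimage_id product_measure1E// lte_mul_pinfty// ge0_fin_numE.
Qed.

HB.instance Definition _ := @Measure_isSigmaFinite.Build _ _ _ cons_measure
  cons_measure_sigma_finite.

End cons_measure.


(* The d-fold product of lebesgue_measure on the Borel sets of R^d; R^0 is a
   single point of mass 1. *)
Fixpoint borel_lebesgue (R : realType) (d : nat) :
    {sigma_finite_measure set (borel_rV R d) -> \bar R} :=
  match d with
  | 0%N => @dirac _ (borel_rV R 0) (0 : 'rV[R]_0) R
  | d'.+1 => cons_measure (borel_lebesgue R d')
  end.

Section lebesgue_rV.
Variables (R : realType) (d : nat).

Definition lebesgue_outer_rV : set 'rV[R]_d -> \bar R :=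
  ((borel_lebesgue R d)^*)%mu.

HB.instance Definition _ := isOuterMeasure.Build _ _ lebesgue_outer_rV
  (mu_ext0 (measure0 (borel_lebesgue R d)) (measure_ge0 (borel_lebesgue R d)))
  (mu_ext_ge0 (measure_ge0 (borel_lebesgue R d)))
  (le_mu_ext (borel_lebesgue R d))
  (mu_ext_sigma_subadditive (measure_ge0 (borel_lebesgue R d))).

Fact lebesgue_rV_display : measure_display. Proof. exact. Qed.

(* As a measurable space, 'rV[R]_d carries the Lebesgue sigma-algebra: the
   Caratheodory-measurable sets of the outer measure, i.e. the completion of the
   Borel sets.  A measurable function on 'rV[R]_d is thus a Lebesgue-measurable
   one. *)
HB.instance Definition _ := @isMeasurable.Build lebesgue_rV_display 'rV[R]_d
  (lebesgue_outer_rV.-caratheodory)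
  (caratheodory_measurable_set0 lebesgue_outer_rV)
  (@caratheodory_measurable_setC _ _ lebesgue_outer_rV)
  (@caratheodory_measurable_bigcup _ _ lebesgue_outer_rV).

Definition lebesgue_rV : set 'rV[R]_d -> \bar R := lebesgue_outer_rV.

HB.instance Definition _ := isMeasure.Build _ _ _ lebesgue_rV
  (@caratheodory_measure0 _ _ lebesgue_outer_rV)
  (@caratheodory_measure_ge0 _ _ lebesgue_outer_rV)
  (@caratheodory_measure_sigma_additive _ _ lebesgue_outer_rV).

End lebesgue_rV.

Arguments lebesgue_rV : clear implicits.

Section euclidean.
Variables (R : realType) (d : nat).
Implicit Types (x : 'rV[R]_d) (V : 'rV[R]_d -> R).

(* The library norm on 'rV[R]_d is the sup norm. *)
Definition enorm x : R := Num.sqrt (\sum_(i < d) x ord0 i ^+ 2).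

Definition unit_ball x : set 'rV[R]_d := [set y | enorm (y - x) < 1].

Definition partial (i : 'I_d) V : 'rV[R]_d -> R :=
  fun x => 'D_(delta_mx ord0 i) V x.

Definition grad V x : 'rV[R]_d := \row_(i < d) partial i V x.

Definition laplacian V x : R := \sum_(i < d) partial i (partial i V) x.

Definition C1 V : Prop :=
  forall i : 'I_d, (forall x, derivable V x (delta_mx ord0 i)) /\
                   continuous (partial i V).

Definition C2 V : Prop :=
  [/\ continuous V, C1 V & forall i : 'I_d, C1 (partial i V)].

Definition weight V x : R := expR (- V x).

Definition weight_plus V x : R :=
  weight V x + (fine (lebesgue_rV R d (unit_ball x)))^-1 *
    \int[lebesgue_rV R d]_(y in unit_ball x) weight V y.

End euclidean.

(* Main.v *)
(* With W = exp(-V) the Laplacian of W is W (|grad V|^2 - lap V), which is at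
   least rho W far from the origin because s < 1.  Testing this against a
   compactly supported bump psi in second-difference form (so that psi only has
   to be C^{1,1} and no integration by parts is needed, only translation
   invariance) compares two averages of W over the unit ball: one is pointwise
   larger than the other by a fixed factor outside a cube K.  By Fubini the
   averages can be moved onto u^p, where averaging costs at most a factor
   1 + eps and a multiple of the nonlocal energy E; this bounds the integral of
   u^p W by C (int_K u^p + E) for bounded u >= 0, and truncation gives the same
   bound for u = |f - c|.  On the bounded set K, averaging over c = f y with y
   in a small cube, chains of small cubes bound int_K |f - c|^p by C E.  Finally
   the mean-zero condition controls |c|^p by the integral of |f - c|^p W. *)

(* The gain comes from total masses. Second differences integrate to zero, so [kappa h] has mass a =
   [kappa_bound] m, with m the mass of the unit ball. The kernel [kernel0] has mass b = a + rho / 2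
   psi, with psi the mass of the bump. Outside K the heavier kernel nevertheless gives the smaller
   average of W. Once moved onto u^p, each average reproduces the mass of its kernel up to 1 + eps,
   so I = int u^p W satisfies b I <= (1 + eps)^2 a I + C (int_K u^p + E), and eps is taken with (1 +
   eps)^2 a < b. Absorbing the I on the right requires I to be finite; hence the detour through
   bounded u. How small h must be depends on the point x, with no uniformity on the unbounded
   complement of K. Fatou's lemma along h -> 0 removes this dependence, because the mass and the
   size of [kappa h] are bounded uniformly in h. The same multiple of the ball indicator enters both
   kernels. It keeps them nonnegative, so every exchange of integrals is an instance of Tonelli. *)
Require Import Defs.
From HB Require Import structures.
From mathcomp Require Import all_boot all_order all_algebra.
From mathcomp Require Import all_classical all_reals all_analysis.
From mathcomp Require Import measurable_realfun ring lra.

Set Implicit Arguments.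
Unset Strict Implicit.
Unset Printing Implicit Defensive.

Import Order.TTheory GRing.Theory Num.Theory.
Import numFieldNormedType.Exports.

Local Open Scope classical_set_scope.
Local Open Scope ring_scope.

(** * Translation invariance of Lebesgue measure on row vectors *)

Section lebesgue_borel.
Context {R : realType}.

Lemma measurable_shift1 (a : R) :
  measurable_fun setT ((fun t => t + a) : measurableTypeR R -> measurableTypeR R).
Proof. exact: measurable_funD. Qed.

Lemma lebesgue_measure_shift (a : R) (A : set (measurableTypeR R)) : measurable A ->
  lebesgue_measure ((fun t : measurableTypeR R => t + a) @^-1` A) = lebesgue_measure A.
Proof.
pose f : measurableTypeR R -> measurableTypeR R := fun t => t + a.
have mf : measurable_fun setT f := measurable_shift1 a.
move=> mA.
pose mfm := isMeasurableFun.Build _ _ _ _ f mf.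
pose fm : {mfun measurableTypeR R >-> measurableTypeR R} := HB.pack f mfm.
apply/esym.
apply: (@lebesgue_measure_unique R (pushforward lebesgue_measure fm)) => //= _ [[b c]] _ <-.
rewrite /pushforward /=.
have -> : fm @^-1` `]b, c] = `]b - a, c - a]%classic.
  by apply/seteqP; split => x /=; rewrite /fm /f !in_itv/=; lra.
by rewrite !lebesgue_measure_itv/= !lte_fin ltrD2r -!EFinB opprB addrA subrK.
Qed.

Variable d : nat.
Notation B := (borel_rV R d).
Notation L := 'rV[R]_d.

Lemma measurable_borel_shift (v : L) :
  measurable_fun setT ((fun x : L => x + v) : B -> B).
Proof.
apply: measurable_fun_borel_rVP => i.
apply: (eq_measurable_fun (fun x : B => (x : L) ord0 i + v ord0 i)).
  by move=> x _; rewrite mxE.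
by apply: measurable_funD => //; exact: measurable_borel_rV_coord.
Qed.

End lebesgue_borel.

(** Induction on the dimension: a shift by [cons_rV (a, w)] acts on the two factors separately, so
    the shifted product measure agrees with the original on rectangles, and product measures are
    unique. *)
Lemma borel_lebesgue_shift (R : realType) (d : nat) (v : 'rV[R]_d)
    (A : set (borel_rV R d)) : measurable A ->
  borel_lebesgue R d ((fun x : 'rV[R]_d => x + v) @^-1` A) = borel_lebesgue R d A.
Proof.
elim: d v A => [|d IH] v A mA.
  congr (borel_lebesgue R 0 _); apply/seteqP.
  by split=> x /=; rewrite !(flatmx0, thinmx0).
rewrite /= /cons_measure /pushforward.
have [a [w ->]] : exists a w, v = cons_rV (a, w).
  by rewrite -(uncons_rVK v); case: (uncons_rV v) => a w; exists a, w.
pose f (z : measurableTypeR R * borel_rV R d) : measurableTypeR R * borel_rV R d :=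
  (z.1 + a, (z.2 : 'rV[R]_d) + w).
have mf : measurable_fun setT f.
  apply/measurable_fun_pairP; split.
    exact: (measurableT_comp (measurable_shift1 a) measurable_fst).
  exact: (measurableT_comp (measurable_borel_shift w) measurable_snd).
have fE (z : measurableTypeR R * borel_rV R d) :
    (cons_rV z : 'rV[R]_d.+1) + cons_rV (a, w) = cons_rV (f z).
  have -> : cons_rV (f z) = row_mx (z.1%:M + a%:M) ((z.2 : 'rV[R]_d) + w) :> 'rV[R]_(1 + d).
    by rewrite -raddfD.
  exact: (@add_row_mx _ 1 1 d).
have -> : @cons_rV R d @^-1` ((fun x : 'rV[R]_d.+1 => x + cons_rV (a, w)) @^-1` A) =
    f @^-1` (@cons_rV R d @^-1` A).
  by apply/seteqP; split => z; rewrite /preimage /mkset fE.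
have mcA : measurable (@cons_rV R d @^-1` A).
  by rewrite -[X in measurable X]setTI; exact: measurable_cons_rV.
pose mfm := isMeasurableFun.Build _ _ _ _ f mf.
pose fm : {mfun (measurableTypeR R * borel_rV R d)%type >->
   (measurableTypeR R * borel_rV R d)%type} := HB.pack f mfm.
apply/esym; apply: (@product_measure_unique _ _ _ _ _ _ _
   (pushforward (lebesgue_measure \x borel_lebesgue R d)%E fm)) => //= C D mC mD.
rewrite /pushforward.
have -> : fm @^-1` (C `*` D) = ((fun t => t + a) @^-1` C) `*` ((fun x : 'rV[R]_d => x + w) @^-1` D) by [].
rewrite product_measure1E.
- by congr (_ * _)%E; [exact: lebesgue_measure_shift | exact: IH].
- by rewrite -[X in measurable X]setTI; exact: measurable_shift1.
- by rewrite -[X in measurable X]setTI; exact: measurable_borel_shift.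
Qed.

Section lebesgue_rV_theory.
Context {R : realType} {d : nat}.
Notation B := (borel_rV R d).
Notation L := 'rV[R]_d.
Notation mu := (lebesgue_rV R d).

Lemma measurable_borel_lebesgue (A : set L) :
  measurable (A : set B) -> measurable A.
Proof.
move=> mA; apply: (@sub_caratheodory _ _ _ (borel_lebesgue R d) A).
exact: sub_sigma_algebra.
Qed.

Lemma lebesgue_borelE (A : set L) : measurable (A : set B) ->
  mu A = borel_lebesgue R d A.
Proof. by move=> mA; exact: measurable_mu_extE. Qed.

Lemma lebesgue_rV_sigma_finite : sigma_finite setT mu.
Proof.
have [F FT Foo] := sigma_finiteT (borel_lebesgue R d).
exists F => // n; have [mF ?] := Foo n; split.
  exact: measurable_borel_lebesgue.
by rewrite lebesgue_borelE.
Qed.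

HB.instance Definition _ := @Measure_isSigmaFinite.Build _ _ _ mu
  lebesgue_rV_sigma_finite.

Lemma measurable_id_borel : measurable_fun setT (idfun : L -> B).
Proof. by move=> _ A mA; rewrite setTI; exact: measurable_borel_lebesgue. Qed.

Lemma measurable_fun_borel_lebesgue (e : measure_display) (T : measurableType e)
    (f : L -> T) :
  measurable_fun setT (f : B -> T) -> measurable_fun setT f.
Proof. by move=> mf; exact: (measurableT_comp mf measurable_id_borel). Qed.

(** For a Borel integrand the integral equals the one against [borel_lebesgue], so invariance on
    Borel sets suffices and null sets never enter. Kernels, bumps, cube indicators and the weight
    are all Borel. *)
Lemma integral_lebesgue_shift (F : L -> \bar R) (v : L) :
  measurable_fun setT (F : B -> \bar R) -> (forall x, 0 <= F x)%E ->
  (\int[mu]_x F (x + v)%R = \int[mu]_x F x)%E.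
Proof.
have e1 (G : L -> \bar R) : measurable_fun setT (G : B -> \bar R) ->
    (forall x, 0 <= G x)%E ->
    (\int[mu]_x G x = \int[borel_lebesgue R d]_(x in [set: B]) G x)%E.
  move=> mG G0.
  pose mfm := isMeasurableFun.Build _ _ _ _ _ measurable_id_borel.
  pose fm : {mfun L >-> B} := HB.pack (idfun : L -> B) mfm.
  rewrite [RHS](eq_measure_integral (pushforward mu fm)); last first.
    by move=> A mA _; rewrite /pushforward /= -lebesgue_borelE.
  by rewrite [RHS](ge0_integral_pushforward measurable_id_borel).
move=> mF F0; have ms := measurable_borel_shift v.
rewrite (e1 F)// (e1 (fun x => F (x + v)%R))//; last exact: (measurableT_comp mF ms).
pose mfm := isMeasurableFun.Build _ _ _ _ _ ms.
pose fm : {mfun B >-> B} := HB.pack (fun x : L => x + v)%R mfm.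
rewrite [RHS](eq_measure_integral (pushforward (borel_lebesgue R d) fm)); last first.
  by move=> A mA _; apply: esym; exact: borel_lebesgue_shift.
by rewrite [RHS](ge0_integral_pushforward ms).
Qed.

End lebesgue_rV_theory.

(** * Cubes and Borel sets *)

Section borel_continuous.
Context {R : realType} {d : nat}.
Notation B := (borel_rV R d).
Notation L := 'rV[R]_d.
Notation mu := (lebesgue_rV R d).

(** The open sup-norm ball, written by coordinates. When e <= 0 it is empty, except in dimension 0,
    where it is always the whole space. *)
Definition cube (x : L) (e : R) : set L :=
  [set y | forall i, `|y ord0 i - x ord0 i| < e].

Lemma measurable_borel_coord_dist (x : L) (i : 'I_d) :
  measurable_fun setT (fun y : B => `|(y : L) ord0 i - x ord0 i|).
Proof.
apply: measurableT_comp => //; apply: measurable_funB => //.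
exact: measurable_borel_rV_coord.
Qed.

Lemma measurable_borel_cube x e : measurable (cube x e : set B).
Proof.
have -> : cube x e = \bigcap_(i in [set: 'I_d]) ((fun y : L => `|y ord0 i - x ord0 i|) @^-1` `]-oo, e[).
  apply/seteqP; split => y /= h.
    by move=> i _; rewrite /= in_itv/=.
  by move=> i; have := h i Logic.I; rewrite /= in_itv.
apply: fin_bigcap_measurable => // i _.
rewrite -[X in measurable X]setTI.
by apply: (measurable_borel_coord_dist x i).
Qed.

Lemma cube_nbhs (x : L) e : 0 < e -> nbhs x (cube x e).
Proof.
move=> e0; apply/nbhs_ballP; exists e => //= y [_ h] i.
by rewrite distrC; exact: h.
Qed.

Lemma nbhs_cube (x : L) (U : set L) : nbhs x U -> exists2 e, 0 < e & cube x e `<=` U.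
Proof.
move=> /nbhs_ballP[e /= e0 eU]; exists e => // y xy; apply: eU; split => // i j.
by rewrite (ord1 i) /ball /= distrC; exact: xy.
Qed.

(** U is the union of the countably many cubes with rational centre and radius 1 / (n + 1) that it
    contains. *)
Lemma open_measurable_borel (U : set L) : open U -> measurable (U : set B).
Proof.
move=> oU.
pose b (k : 'rV[rat]_d * nat) : set L := cube (map_mx ratr k.1) k.2.+1%:R^-1.
have -> : U = \bigcup_(k in [set k | b k `<=` U]) b k.
  apply/seteqP; split => [x Ux|x [k kU kx]]; last exact: kU.
  have [e e0 eU] := nbhs_cube (open_nbhs_nbhs (conj oU Ux)).
  pose n := Num.truncn (2 / e).
  (* A cube of this radius around a rational point closer than the radius to x contains x, and each
     of its points is within e of x. *)
  have ne : n.+1%:R^-1 < e / 2.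
    rewrite -[e / 2]invrK ltf_pV2 ?posrE ?invr_gt0 ?divr_gt0//.
    by rewrite invf_div truncnS_gt.
  have /choice[q qP] : forall i : 'I_d, exists q : rat, `|ratr q - x ord0 i| < n.+1%:R^-1.
    move=> i; have [|q] := @rat_in_itvoo R (x ord0 i - n.+1%:R^-1) (x ord0 i + n.+1%:R^-1).
      by rewrite ltrBlDr -addrA ltrDl addr_gt0 ?invr_gt0.
    by rewrite in_itv/= => h; exists q; rewrite ltr_distl.
  exists (\row_i q i, n) => /=; last by move=> i; rewrite !mxE distrC.
  move=> y yb; apply: eU => i; have := yb i; rewrite !mxE => h.
  rewrite (le_lt_trans (ler_distD (ratr (q i)) _ _))// [ltRHS]splitr.
  by rewrite ltrD// (lt_trans _ ne).
rewrite bigcup_mkcond; apply: countable_bigcupT_measurable => // k.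
by case: ifP => // _; exact: measurable_borel_cube.
Qed.

Lemma continuous_measurable_borel (F : L -> R) : continuous F ->
  measurable_fun setT (F : B -> R).
Proof.
move=> /continuousP cF; apply: (measurability _ (RGenOInfty.measurableE R)).
move=> _ [_ [a ->] <-]; rewrite setTI.
by apply: open_measurable_borel; apply: cF; exact: interval_open.
Qed.

(** The source carries the product of the Lebesgue sigma-algebras, the target only the Borel one:
    the preimage of a null set under subtraction need not lie in that product. This is why kernels
    are required to be Borel. *)
Lemma measurable_diff2 :
  measurable_fun setT (fun z : L * L => (z.2 - z.1 : B)).
Proof.
apply: measurable_fun_borel_rVP => i.
apply: (eq_measurable_fun (fun z : L * L => z.2 ord0 i - z.1 ord0 i)).
  by move=> z _; rewrite !mxE.
have mc : measurable_fun setT (fun x : L => x ord0 i).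
  by apply: measurable_fun_borel_lebesgue; exact: measurable_borel_rV_coord.
by apply: measurable_funB; [exact: (measurableT_comp mc measurable_snd)|
  exact: (measurableT_comp mc measurable_fst)].
Qed.

Lemma measurable_borel_enorm : measurable_fun setT (@enorm R d : B -> R).
Proof.
apply: (measurableT_comp (continuous_measurable_fun (@sqrt_continuous R))).
by apply: measurable_sum => i; apply: measurable_funX; exact: measurable_borel_rV_coord.
Qed.

(** Each square is at most 1 / (d + 1) and there are d of them; taking d + 1 gives strictness and
    covers d = 0. *)
Lemma cube_enorm (v : L) : (forall i, `|v ord0 i| <= (d.+1%:R)^-1) -> enorm v < 1.
Proof.
move=> h; rewrite /enorm -(sqrtr1 R) ltr_sqrt//.
apply: (@le_lt_trans _ _ (\sum_(i < d) (d.+1%:R^-1 : R))); last first.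
  rewrite sumr_const card_ord -[ltLHS]mulr_natl ltr_pdivrMr// mul1r ltr_nat//.
apply: ler_sum => i _; rewrite -real_normK ?num_real// expr2.
rewrite (le_trans (ler_pM _ _ (h i) (h i)))// ler_piMr// ?invr_ge0//.
by rewrite invf_le1// ler1n.
Qed.

Lemma enorm_coord (v : L) i : `|v ord0 i| <= enorm v.
Proof.
rewrite /enorm -sqrtr_sqr ler_wsqrtr// (bigD1 i)//= lerDl.
by apply: sumr_ge0 => j _; exact: sqr_ge0.
Qed.

Lemma measurable_borel_unit_ball x : measurable (unit_ball x : set B).
Proof.
have -> : unit_ball x = (fun y : B => enorm ((y : L) + - x)) @^-1` `]-oo, 1[.
  by apply/seteqP; split => y /=; rewrite in_itv.
have m := measurableT_comp measurable_borel_enorm (measurable_borel_shift (- x)).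
by rewrite -[X in measurable X]setTI; apply: m.
Qed.

End borel_continuous.

(** * Second differences of the weight *)

(** The constant c makes G(t) = w(t) + w(-t) - c t^2 take equal values at 0 and h. Rolle's theorem
    gives s with w1(s) - w1(-s) = 2 c s, and the mean value theorem for w1 on [-s, s] identifies c
    with a value of w2. Continuity of w2 is not involved. *)
Lemma second_difference (R : realType) (w w1 w2 : R -> R) (h : R) :
  (forall t : R, is_derive t 1 w (w1 t)) -> (forall t : R, is_derive t 1 w1 (w2 t)) ->
  0 < h -> exists2 t, `|t| < h & w h + w (- h) = 2 * w 0 + h ^+ 2 * w2 t.
Proof.
move=> dw dw1 h0.
have dcont (f df : R -> R) : (forall t : R, is_derive t 1 f (df t)) -> continuous f.
  move=> df_ t; apply: differentiable_continuous; apply/derivable1_diffP.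
  by have [] := df_ t.
pose c := (w h + w (- h) - 2 * w 0) / h ^+ 2.
pose G t := w t + w (- t) - c * (t * t).
pose dG t := w1 t - w1 (- t) - c * (2 * t).
have dGP (t : R) : is_derive t 1 G (dG t).
  have dwN := is_derive1_comp (dw (- t)) (is_deriveNid t 1).
  have dsq := is_deriveZ c (is_deriveM (is_derive_id t 1) (is_derive_id t 1)).
  apply: (is_derive_eq (is_deriveB (is_deriveD (dw t) dwN) dsq)).
  rewrite /dG /GRing.scale/=; ring.
have [s] : exists2 s, s \in `]0, h[ & G h - G 0 = dG s * (h - 0).
  apply: MVT => //; apply: continuous_subspaceT; exact: (dcont _ dG).
rewrite in_itv/= => /andP[s0 sh].
have -> : G h - G 0 = 0.
  by rewrite /G oppr0 mulr0 mulr0 subr0 -expr2 /c mulfVK ?expf_neq0 ?gt_eqF//; ring.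
rewrite subr0 => /esym/eqP; rewrite mulf_eq0 (gt_eqF h0) orbF => /eqP dGs.
have [t] : exists2 t, t \in `]-s, s[ & w1 s - w1 (- s) = w2 t * (s - (- s)).
  apply: MVT => //; first by rewrite gtrN.
  apply: continuous_subspaceT; exact: (dcont _ w2).
rewrite in_itv/= => /andP[st ts] w1E.
exists t; first by rewrite ltr_norml; apply/andP; split; lra.
have ct : c = w2 t.
  move: dGs; rewrite /dG w1E => e.
  apply: (@mulIf _ (2 * s)); first by rewrite mulf_neq0 ?gt_eqF.
  lra.
rewrite -ct /c [h ^+ 2 * _]mulrC mulfVK ?expf_neq0 ?gt_eqF//; ring.
Qed.

Section weight_calculus.
Context {R : realType} {d : nat}.
Notation L := 'rV[R]_d.
Variable V : L -> R.
Hypothesis hV : C2 V.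
Notation W := (weight V).
Local Notation e_ i := (delta_mx ord0 i : L).

Lemma is_derive_line (U : L -> R) (x v : L) (t : R) :
  derivable U (x + t *: v) v ->
  is_derive t 1 (fun t => U (x + t *: v)) ('D_v U (x + t *: v)).
Proof.
move=> dU.
have E : (fun h : R => h^-1 *: ((fun t => U (x + t *: v)) (h *: 1 + t) - U (x + t *: v))) =
   (fun h : R => h^-1 *: (U (h *: v + (x + t *: v)) - U (x + t *: v))).
  apply/funext => h /=; congr (_ *: (U _ - _)).
  by rewrite (_ : h *: (1 : R) = h) ?scalerDl 1?addrCA//; exact: mulr1.
by split; rewrite /derivable /derive /= E.
Qed.

(** The second derivative of exp(-V) in direction i, in closed form. *)
Definition weight_dd (i : 'I_d) (x : L) : R :=
  W x * (partial i V x * partial i V x - partial i (partial i V) x).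

Lemma weight_gt0 x : 0 < W x. Proof. exact: expR_gt0. Qed.

Lemma continuous_weight : continuous W.
Proof.
move=> x; have [cV _ _] := hV.
apply: (@continuous_comp _ _ _ (fun x => - V x) expR); last exact: continuous_expR.
exact: (continuousN (cV x)).
Qed.

Lemma continuous_weight_dd i : continuous (weight_dd i).
Proof.
move=> x; have [_ V1 V2] := hV.
have [_ c1] := V1 i; have [_ c2] := V2 i i.
apply: continuousM; first exact: continuous_weight.
by apply: continuousB; [apply: continuousM; exact: c1|exact: c2].
Qed.

Lemma weight_second_difference (i : 'I_d) (x : L) (h : R) : 0 < h ->
  exists2 t, `|t| < h &
    W (x + h *: e_ i) + W (x - h *: e_ i) =
    2 * W x + h ^+ 2 * weight_dd i (x + t *: e_ i).
Proof.
move=> h0; have [_ V1 V2] := hV.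
have [d1 _] := V1 i; have [d2 _] := V2 i i.
pose f t := V (x + t *: e_ i); pose f1 t := partial i V (x + t *: e_ i).
pose f2 t := partial i (partial i V) (x + t *: e_ i).
have df (t : R) : is_derive t 1 f (f1 t) by exact: is_derive_line.
have df1 (t : R) : is_derive t 1 f1 (f2 t) by exact: is_derive_line.
pose w t := expR (- f t); pose w1 t := - f1 t * w t.
pose w2 t := w t * (f1 t * f1 t - f2 t).
have dw (t : R) : is_derive t 1 w (w1 t).
  have D := @is_derive1_comp R expR (- f) t _ _ (is_derive_expR (- f t)) (is_deriveN (df t)).
  apply: (is_derive_eq D).
  by rewrite /w1 mulrC.
have dw1 (t : R) : is_derive t 1 w1 (w2 t).
  apply: (is_derive_eq (is_deriveM (is_deriveN (df1 t)) (dw t))).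
  rewrite /w2 /w1 /GRing.scale/= !fctE; ring.
have [t th] := second_difference dw dw1 h0.
rewrite /w /f /= scaleNr scale0r addr0 => ->.
by exists t.
Qed.

Variables (s rho r : R).
Hypotheses (s01 : 0 < s < 1) (rho0 : 0 < rho).
Hypothesis hL : forall x, r < enorm x ->
  rho <= s * enorm (grad V x) ^+ 2 - laplacian V x.

Lemma sum_weight_dd_ge x : r < enorm x -> rho * W x <= \sum_i weight_dd i x.
Proof.
move=> /hL h; rewrite /weight_dd -mulr_sumr mulrC ler_pM2l ?weight_gt0//.
apply: (le_trans h); rewrite sumrB lerB//.
have -> : \sum_i partial i V x * partial i V x = enorm (grad V x) ^+ 2.
  rewrite /enorm sqr_sqrtr; last by apply: sumr_ge0 => i _; exact: sqr_ge0.
  by apply: eq_bigr => i _; rewrite mxE expr2.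
by case/andP: s01 => s0 s1; rewrite ler_piMl ?sqr_ge0// ltW.
Qed.

Lemma compact_closed_cube (x : L) (e : R) :
  compact [set y : L | forall i, `|y ord0 i - x ord0 i| <= e].
Proof.
have := @rV_compact R d (fun i => `[x ord0 i - e, x ord0 i + e]%classic)
  (fun i => @segment_compact _ _ _).
congr (compact _); apply/seteqP.
by split=> y /= h i; move: (h i); rewrite in_itv/= ler_distl.
Qed.

(** Nearness is joint in the point and in h, the form that a compactness argument turns into one
    threshold on h for a whole closed cube. *)
Lemma weight_second_difference_near (i : 'I_d) (x : L) (eps : R) : 0 < eps ->
  \forall y \near x & h \near 0^'+, h ^+ 2 * (weight_dd i x - eps) + 2 * W y <=
    W (y + h *: e_ i) + W (y - h *: e_ i).
Proof.
move=> eps0.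
have /nbhs_cube[e e0 eP] : nbhs x [set y | weight_dd i x - eps < weight_dd i y].
  have /cvgrPdist_lt/(_ _ eps0) h : weight_dd i y @[y --> x] --> weight_dd i x.
    exact: continuous_weight_dd.
  near=> y.
  have : `|weight_dd i x - weight_dd i y| < eps by near: y.
  by rewrite /= ltr_norml => /andP[_]; rewrite !ltrBlDr addrC.
near=> y h; rewrite addrC.
have h0 : 0 < h by near: h; exact: nbhs_right_gt.
have [t th ->] := weight_second_difference i y h0.
rewrite lerD2l ler_pM2l ?exprn_gt0// ltW//; apply: eP => j.
rewrite !mxE addrAC (le_lt_trans (ler_normD _ _))//.
(* Half of e is spent on y and half on the intermediate point t, with |t| < h < e / 2. *)
have xy : `|y ord0 j - x ord0 j| < e / 2.
  suff : cube x (e / 2) y by apply.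
  by near: y; apply: cube_nbhs; rewrite divr_gt0.
rewrite eqxx/= normrM [ltRHS]splitr.
apply: ltrD => //; apply: (@le_lt_trans _ _ `|t|).
  by rewrite ler_piMr//; case: (_ == _); rewrite ?normr1 ?normr0.
apply: (lt_trans th); near: h; apply: nbhs_right_lt; rewrite divr_gt0//.
Unshelve. all: by end_near. Qed.

End weight_calculus.

(** * The bump and its second-difference kernel *)

Section bump.
Context {R : realType}.
Implicit Types (a t h y z : R).

(** Squaring the positive part makes the derivative Lipschitz across |t| = a, so second differences
    are of order h^2. *)
Definition bump a t : R := Num.max 0 (a ^+ 2 - t ^+ 2) ^+ 2.

Lemma bump_ge0 a t : 0 <= bump a t. Proof. exact: sqr_ge0. Qed.

Lemma bump_le1 a t : 0 <= a <= 1 -> bump a t <= 1.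
Proof.
move=> /andP[a0 a1]; rewrite /bump expr_le1 ?le_max ?lexx//.
by rewrite ge_max ler01/= lerBlDr (le_trans (exprn_ile1 2 _ a1))// lerDl sqr_ge0.
Qed.

Lemma bump_gt0 a t : `|t| < a -> 0 < bump a t.
Proof.
move=> ta; rewrite /bump exprn_gt0// lt_max; apply/orP; right.
by rewrite subr_gt0 -(real_normK (num_real t)) ltrXn2r// (le_lt_trans _ ta).
Qed.

Lemma bump_eq0 a t : 0 <= a -> a <= `|t| -> bump a t = 0.
Proof.
move=> a0 ta; rewrite /bump (max_idPl _) ?expr0n//.
by rewrite subr_le0 -(real_normK (num_real t)) lerXn2r ?nnegrE.
Qed.

(** The function max(0, y)^2 is convex with derivative 2 max(0, y), which is 2-Lipschitz; the
    first-order Taylor remainder therefore lies between 0 and (z - y)^2. *)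
Lemma sqr_pos_taylor y z :
  0 <= Num.max 0 z ^+ 2 - Num.max 0 y ^+ 2 - 2 * Num.max 0 y * (z - y) <= (z - y) ^+ 2.
Proof.
have s2 := sqr_ge0 (z - y); have s1 := sqr_ge0 y; have s3 := sqr_ge0 z.
case: (leP 0 y) => y0; case: (leP 0 z) => z0;
  rewrite ?expr0n/= ?mulr0 ?mul0r ?subr0 ?sub0r; apply/andP; split; nra.
Qed.

(** If |t| > 2 all three values vanish. Otherwise expand at y = a^2 - t^2: the increments are -2th -
    h^2 and 2th - h^2. The linear terms add up to -4 h^2 max(0, y), and the remainders to at most 8
    t^2 h^2 + 2 h^4 <= 34 h^2. The constant is 38 = 4 + 34. *)
Lemma bump_second_difference a t h : 0 <= a <= 1 -> 0 <= h <= 1 ->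
  `|bump a (t + h) + bump a (t - h) - 2 * bump a t| <= 38 * h ^+ 2.
Proof.
move=> /andP[a0 a1] /andP[h0 h1].
case: (ltP 2 `|t|) => t2.
  rewrite !bump_eq0 ?mulr0 ?subr0 ?addr0 ?normr0 ?mulr_ge0 ?sqr_ge0//.
  - by rewrite (le_trans a1)// ltW// (lt_trans _ t2)// ltr1n.
  - by have := lerB_dist t h; rewrite (ger0_norm h0); lra.
  - by have := lerB_normD t h; rewrite (ger0_norm h0); lra.
move: t2; rewrite ler_norml => /andP[tm tp].
rewrite /bump; set y := a ^+ 2 - t ^+ 2.
have /andP[l1 u1] := sqr_pos_taylor y (a ^+ 2 - (t + h) ^+ 2).
have /andP[l2 u2] := sqr_pos_taylor y (a ^+ 2 - (t - h) ^+ 2).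
have y1 : 0 <= Num.max 0 y <= 1.
  by rewrite le_max lexx/= ge_max ler01/= /y; nra.
move: l1 u1 l2 u2 y1; rewrite /y.
set m := Num.max 0 (_ - t ^+ 2).
set p := Num.max 0 (_ - (t + h) ^+ 2) ^+ 2.
set q := Num.max 0 (_ - (t - h) ^+ 2) ^+ 2.
move=> l1 u1 l2 u2 /andP[m0 m1].
have tt : t ^+ 2 <= 4 by nra.
have hh : 0 <= h ^+ 2 <= 1 by nra.
rewrite ler_norml; apply/andP; split; nra.
Qed.

End bump.

Section kernels.
Context {R : realType} {d : nat}.
Notation B := (borel_rV R d).
Notation L := 'rV[R]_d.
Local Notation e_ i := (delta_mx ord0 i : L).

(** Half of the threshold in [cube_enorm]: the support of the bump, shifted by at most [eta] along
    an axis, stays in the unit ball. *)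
Definition bump_radius : R := (2 * d.+1%:R)^-1.
Local Notation eta := bump_radius.

Lemma bump_radius_gt0 : 0 < eta.
Proof. by rewrite invr_gt0 mulr_gt0. Qed.

Lemma bump_radius_le1 : 0 <= eta <= 1.
Proof.
rewrite ltW ?bump_radius_gt0//= invf_le1 ?mulr_gt0//.
by rewrite -natrM ler1n.
Qed.

Lemma bump_radiusD : eta + eta = d.+1%:R^-1.
Proof.
rewrite /bump_radius invfM -mulr2n -[LHS]mulr_natl mulrA divff ?mul1r//.
Qed.

Definition bump_rV (v : L) : R := \prod_i bump eta (v ord0 i).

Lemma bump_rV_ge0 v : 0 <= bump_rV v.
Proof. by apply: prodr_ge0 => i _; exact: bump_ge0. Qed.

Lemma bump_rV_le1 v : bump_rV v <= 1.
Proof.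
by apply: prodr_ile1 => i _; rewrite bump_ge0 bump_le1// bump_radius_le1.
Qed.

Lemma bump_rV_eq0 (v : L) i : eta <= `|v ord0 i| -> bump_rV v = 0.
Proof.
by move=> h; rewrite /bump_rV (bigD1 i)//= bump_eq0 ?mul0r// ltW ?bump_radius_gt0.
Qed.

Lemma bump_rV_gt0 (v : L) : cube 0 eta v -> 0 < bump_rV v.
Proof.
move=> h; apply: prodr_gt0 => i _; apply: bump_gt0.
by have := h i; rewrite mxE subr0.
Qed.

Lemma bump_rV_shift (v : L) i h : bump_rV (v + h *: e_ i) =
  bump eta (v ord0 i + h) * \prod_(j | j != i) bump eta (v ord0 j).
Proof.
rewrite /bump_rV (bigD1 i)//= !mxE !eqxx mulr1; congr (_ * _).
by apply: eq_bigr => j ji; rewrite !mxE (negbTE ji) andbF mulr0 addr0.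
Qed.

Lemma bump_rV_second_difference (v : L) i h : 0 <= h <= 1 ->
  `|bump_rV (v + h *: e_ i) + bump_rV (v - h *: e_ i) - 2 * bump_rV v| <= 38 * h ^+ 2.
Proof.
move=> h01; rewrite -scaleNr 2!bump_rV_shift.
have := bump_rV_shift v i 0; rewrite scale0r !addr0 => ->.
rewrite mulrA -mulrDl -mulrBl normrM.
rewrite (le_trans (ler_pM _ _ (bump_second_difference _ bump_radius_le1 h01) (_ : _ <= 1)))//.
  rewrite ger0_norm; last by apply: prodr_ge0 => j _; exact: bump_ge0.
  by apply: prodr_ile1 => j _; rewrite bump_ge0 bump_le1// bump_radius_le1.
by rewrite mulr1.
Qed.

(** By [cube_enorm], some coordinate of a point outside the ball is at least 2 eta in absolute
    value, and a shift by h leaves it at least eta. *)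
Lemma bump_rV_out (v : L) i h : ~ unit_ball 0 v -> 0 <= h <= eta ->
  [/\ bump_rV v = 0, bump_rV (v + h *: e_ i) = 0 & bump_rV (v - h *: e_ i) = 0].
Proof.
move=> vB /andP[h0 heta].
have [j vj] : exists j, eta + eta <= `|v ord0 j|.
  apply: contrapT => /forallNP hj; apply: vB; rewrite /unit_ball /= subr0; apply: cube_enorm => j.
  rewrite -bump_radiusD; case: (leP (eta + eta) `|v ord0 j|) => [/hj//|/ltW//].
have b j' : `|h * (j' == i)%:R| <= eta.
  by rewrite normrM ger0_norm//; case: eqP => _; rewrite ?normr1 ?normr0 ?mulr1 ?mulr0 ?(le_trans h0).
split; apply: (@bump_rV_eq0 _ j).
- by rewrite (le_trans _ vj)// lerDl ltW// bump_radius_gt0.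
- rewrite !mxE eqxx/=; have bj := b j.
  by have := lerB_normD (v ord0 j) (h * (j == i)%:R); apply: le_trans; lra.
- rewrite !mxE eqxx/=; have bj := b j.
  by have := lerB_dist (v ord0 j) (h * (j == i)%:R); apply: le_trans; lra.
Qed.

Definition ball1 : L -> R := \1_(unit_ball (0 : L)).
(** Bounds h^-2 times the sum of the d second differences of the bump, for every h in (0, eta]. *)
Definition kappa_bound : R := 38 * d%:R.

(* The multiple of the ball indicator makes the kernel nonnegative. *)
Definition kappa h (v : L) : R := kappa_bound * ball1 v + h ^- 2 *
  \sum_i (bump_rV (v + h *: e_ i) + bump_rV (v - h *: e_ i) - 2 * bump_rV v).

Lemma ball1E v : ball1 v = if enorm v < 1 then 1 else 0.
Proof.
rewrite /ball1 indicE; case: ifPn => h.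
  by rewrite mem_set//= /unit_ball/= subr0.
by rewrite memNset//= /unit_ball/= subr0; exact/negP.
Qed.

Lemma ball1_ge0 v : 0 <= ball1 v.
Proof. by rewrite ball1E; case: ifP. Qed.

Lemma ball1_le1 v : ball1 v <= 1.
Proof. by rewrite ball1E; case: ifP. Qed.

Lemma bump_rV_le_ball1 v : bump_rV v <= ball1 v.
Proof.
rewrite ball1E; case: ifPn => h; first exact: bump_rV_le1.
have [j vj] : exists j, eta + eta <= `|v ord0 j|.
  apply: contrapT => /forallNP hj; move/negP: h; apply; apply: cube_enorm => j.
  rewrite -bump_radiusD; case: (leP (eta + eta) `|v ord0 j|) => [/hj//|/ltW//].
by rewrite (@bump_rV_eq0 _ j)// (le_trans _ vj)// lerDl ltW// bump_radius_gt0.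
Qed.

Lemma kappa_bound_ge0 : 0 <= kappa_bound.
Proof. by rewrite mulr_ge0. Qed.

Lemma kappa_bounds h v : 0 < h <= eta ->
  0 <= kappa h v <= 2 * kappa_bound * ball1 v.
Proof.
move=> /andP[h0 heta]; have /andP[eta0 eta1] := bump_radius_le1.
have h01 : 0 <= h <= 1 by rewrite ltW// (le_trans heta).
rewrite /kappa; set S := \sum_i _.
suff : `|h ^- 2 * S| <= kappa_bound * ball1 v by rewrite ler_norml; lra.
rewrite ball1E; case: ifPn => [vB|/negP vB].
  rewrite mulr1 normrM normfV (ger0_norm (sqr_ge0 h)) mulrC ler_pdivrMr ?exprn_gt0//.
  rewrite (le_trans (ler_norm_sum _ _ _))// (le_trans (ler_sum _ (fun i _ => bump_rV_second_difference v i h01)))//.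
  by rewrite sumr_const card_ord /kappa_bound -[leLHS]mulr_natr mulrAC.
have vB' : ~ unit_ball 0 v by rewrite /unit_ball/= subr0.
rewrite mulr0 /S big1 ?mulr0 ?normr0// => i _.
have [] := @bump_rV_out v i h vB'; first by rewrite ltW.
by move=> -> -> ->; rewrite mulr0 subr0 addr0.
Qed.

(** The definition of [kappa] cleared of subtraction: every term is now nonnegative, so integrals
    split without any finiteness condition. *)
Lemma kappaE h v : h != 0 ->
  h ^+ 2 * kappa h v + 2 * d%:R * bump_rV v = h ^+ 2 * kappa_bound * ball1 v +
  \sum_i (bump_rV (v + h *: e_ i) + bump_rV (v - h *: e_ i)).
Proof.
move=> h0; rewrite /kappa mulrDr !mulrA mulfV ?expf_neq0// mul1r.
rewrite sumrB sumr_const card_ord -[_ *+ d]mulr_natr; ring.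
Qed.

Lemma measurable_borel_bump : measurable_fun setT (bump_rV : B -> R).
Proof.
apply: measurable_prod => i _; rewrite /bump.
apply: measurable_funX; apply: measurable_maxr => //.
apply: measurable_funB => //; apply: measurable_funX.
exact: measurable_borel_rV_coord.
Qed.

Lemma measurable_borel_ball1 : measurable_fun setT (ball1 : B -> R).
Proof. by apply: measurable_indic; exact: measurable_borel_unit_ball. Qed.

Lemma measurable_borel_kappa h : measurable_fun setT (kappa h : B -> R).
Proof.
apply: measurable_funD.
  by apply: measurable_funM => //; exact: measurable_borel_ball1.
apply: measurable_funM => //; apply: measurable_sum => i.
have mb := measurable_borel_bump.
apply: measurable_funB; last exact: measurable_funM.
by apply: measurable_funD; exact: (measurableT_comp mb (measurable_borel_shift _)).
Qed.

Lemma enorm_distC (x y : L) : enorm (x - y) = enorm (y - x).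
Proof.
by rewrite /enorm; congr Num.sqrt; apply: eq_bigr => i _; rewrite !mxE -sqrrN opprB.
Qed.

End kernels.

(** Choose t > 0 with (1 + t)^p = 1 + eps. If b <= t a then c <= (1 + t) a; otherwise a < b / t and
    c <= (1 + 1 / t) b, whence C = (1 + 1 / t)^p. *)
Lemma powR_le_split (R : realType) (p eps : R) : 1 <= p -> 0 < eps ->
  exists2 C : R, 0 < C & forall a b c, 0 <= a -> 0 <= b -> 0 <= c -> c <= a + b ->
    c `^ p <= (1 + eps) * a `^ p + C * b `^ p.
Proof.
move=> p1 eps0; have p0 : 0 < p by rewrite (lt_le_trans _ p1).
pose t : R := (1 + eps) `^ p^-1 - 1.
have t1 : (1 + t) `^ p = 1 + eps.
  rewrite /t addrCA subrr addr0 -powRrM mulVf ?gt_eqF// powRr1// addr_ge0// ltW//.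
have t0 : 0 < t.
  have -> : t = (1 + eps) `^ p^-1 - 1 `^ p^-1 by rewrite powR1.
  rewrite subr_gt0 gt0_ltr_powR ?invr_gt0 ?nnegrE ?addr_ge0 ?ltrDl// ltW//.
exists ((1 + t^-1) `^ p); first by rewrite powR_gt0// addr_gt0// invr_gt0.
move=> a b c a0 b0 c0 cab.
case: (leP b (t * a)) => bta.
  apply: (@le_trans _ _ ((1 + eps) * a `^ p)); last first.
    by rewrite lerDl mulr_ge0// powR_ge0.
  rewrite -t1 -powRM//; last by rewrite addr_ge0// ltW.
  apply: ge0_ler_powR; rewrite ?nnegrE//; first exact: ltW.
    by rewrite mulr_ge0// addr_ge0// ltW.
  by rewrite mulrDl mul1r (le_trans cab)// lerD2l.
apply: (@le_trans _ _ ((1 + t^-1) `^ p * b `^ p)); last first.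
  by rewrite lerDr mulr_ge0 ?powR_ge0// addr_ge0// ltW.
have ti : 0 <= t^-1 by rewrite invr_ge0 ltW.
rewrite -powRM//; last by rewrite addr_ge0.
apply: ge0_ler_powR; rewrite ?nnegrE//; first exact: ltW.
  by rewrite mulr_ge0// addr_ge0.
rewrite (le_trans cab)// mulrDl mul1r addrC lerD2l.
by rewrite -ler_pdivrMl ?invr_gt0// invrK ltW.
Qed.

(** * Masses of cubes, balls and bumps *)

Section ge0_real_integral.
Context d (T : measurableType d) {R : realType} (mu : {measure set T -> \bar R}).
Implicit Types F G : T -> R.

Lemma le_integral_real F G : measurable_fun setT F -> measurable_fun setT G ->
  (forall x, 0 <= F x <= G x) ->
  (\int[mu]_x (F x)%:E <= \int[mu]_x (G x)%:E)%E.
Proof.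
move=> mF mG FG; apply: ge0_le_integral => //; try exact/measurable_EFinP.
  by move=> x _; rewrite lee_fin; case/andP: (FG x).
by move=> x _; rewrite lee_fin; case/andP: (FG x).
Qed.

Lemma integralD_real F G : measurable_fun setT F -> measurable_fun setT G ->
  (forall x, 0 <= F x) -> (forall x, 0 <= G x) ->
  (\int[mu]_x (F x + G x)%:E = \int[mu]_x (F x)%:E + \int[mu]_x (G x)%:E)%E.
Proof.
move=> mF mG F0 G0; under eq_integral do rewrite EFinD.
by apply: ge0_integralD => //; try exact/measurable_EFinP; move=> x _; rewrite lee_fin.
Qed.

Lemma integralZl_real (c : R) F : measurable_fun setT F ->
  (forall x, 0 <= F x) -> 0 <= c ->
  (\int[mu]_x (c * F x)%:E = c%:E * \int[mu]_x (F x)%:E)%E.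
Proof.
move=> mF F0 c0; under eq_integral do rewrite EFinM.
by apply: ge0_integralZl => //; try exact/measurable_EFinP; move=> x _; rewrite lee_fin.
Qed.

Lemma integral_sum_real (I : Type) (l : seq I) (f : I -> T -> R) :
  (forall i, measurable_fun setT (f i)) -> (forall i x, 0 <= f i x) ->
  (\int[mu]_x (\sum_(i <- l) f i x)%R%:E = \sum_(i <- l) \int[mu]_x (f i x)%:E)%E.
Proof.
move=> mf f0; under eq_integral do rewrite -sumEFin.
have mfE i : measurable_fun setT (fun x => (f i x)%:E) by apply/measurable_EFinP; exact: mf.
have f0E i x : setT x -> (0 <= (f i x)%:E)%E by rewrite lee_fin.
exact: (ge0_integral_sum mu measurableT mfE f0E).
Qed.

End ge0_real_integral.

Section mass.
Context {R : realType} {d : nat}.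
Notation B := (borel_rV R d).
Notation L := 'rV[R]_d.
Notation mu := (lebesgue_rV R d).
Variable V : L -> R.
Hypothesis cW : continuous (weight V).
Notation W := (weight V).
Hypothesis W1 : (\int[mu]_x (W x)%:E = 1)%E.

Lemma measurable_weight : measurable_fun setT W.
Proof. by apply: measurable_fun_borel_lebesgue; exact: continuous_measurable_borel. Qed.

Lemma weight_cube_lb (x : L) (e : R) :
  exists2 w, 0 < w & forall y, cube x e y -> w <= W y.
Proof.
pose K := [set y : L | forall i, `|y ord0 i - x ord0 i| <= e].
have sub : cube x e `<=` K by move=> y xy i; rewrite ltW.
(* The closed cube is empty when e < 0 and d > 0, and then there is no minimum to take. *)
have [[y Ky]|K0] := pselect (K !=set0); last first.
  by exists 1 => // y /sub Ky; exfalso; apply: K0; exists y.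
have cK : compact K := @compact_closed_cube R d x e.
have [c _ cmin] := @EVT_min_rV R d W K (ex_intro _ y Ky) cK (continuous_subspaceT cW).
exists (W c); first exact: weight_gt0.
by move=> z /sub Kz; apply: cmin; rewrite inE.
Qed.

Lemma cube_measurable (x : L) (e : R) : measurable (cube x e).
Proof. by apply: measurable_borel_lebesgue; exact: measurable_borel_cube. Qed.

(** No volume is computed: W is bounded below by some w > 0 on the cube and has total integral 1, so
    the measure is at most 1 / w. *)
Lemma cube_fin (x : L) (e : R) : (mu (cube x e) < +oo)%E.
Proof.
have [w w0 wW] := weight_cube_lb x e.
have : (w%:E * mu (cube x e) <= 1)%E.
  rewrite -W1 -integral_cst; last exact: cube_measurable.
  rewrite integral_mkcond; apply: ge0_le_integral => //.
  - by move=> y _; rewrite patchE; case: ifP => // _; rewrite lee_fin ltW.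
  - apply/(measurable_restrictT _ (cube_measurable x e)); exact: measurable_cst.
  - by apply/measurable_EFinP; exact: measurable_weight.
  - move=> y _; rewrite patchE; case: ifPn => [/set_mem/wW|_]; rewrite lee_fin//.
    by rewrite ltW// weight_gt0.
move=> h; rewrite ltey; apply/eqP => moo; move: h.
by rewrite moo gt0_muley ?lte_fin// leye_eq.
Qed.

Lemma cube_shift (x y : L) (e : R) : mu (cube x e) = mu (cube y e).
Proof.
have E z : mu (cube z e) = (\int[mu]_t (\1_(cube z e) t)%:E)%E.
  by rewrite integral_indic ?setIT//; exact: cube_measurable.
rewrite !E -(integral_lebesgue_shift (F := fun t => (\1_(cube y e) t)%:E) (y - x)).
- apply: eq_integral => t _; congr (_%:E); rewrite !indicE; congr ((nat_of_bool _)%:R).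
  by apply/idP/idP; rewrite !inE => h i; move: (h i); rewrite !mxE;
    congr (`|_| < _); ring.
- apply/measurable_EFinP; apply: measurable_indic; exact: measurable_borel_cube.
- by move=> t; rewrite lee_fin.
Qed.

(** Countably many translates, centred at rational points, cover the space. If they were null the
    whole space would be null, against the integral of W being 1. *)
Lemma cube_gt0 (x : L) (e : R) : 0 < e -> (0 < mu (cube x e))%E.
Proof.
move=> e0; rewrite lt_neqAle measure_ge0 andbT; apply/eqP => /esym m0.
pose F k : set L := if @unpickle 'rV[rat]_d k is Some q then cube (map_mx ratr q) e else set0.
have FT : \bigcup_k F k = setT.
  apply/seteqP; split => // y _.
  have /choice[q qP] : forall i : 'I_d, exists q : rat, `|y ord0 i - ratr q| < e.
    move=> i; have [|q] := @rat_in_itvoo R (y ord0 i - e) (y ord0 i + e).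
      by rewrite ltrBlDr -addrA ltrDl addr_gt0.
    by rewrite in_itv/= => h; exists q; rewrite distrC ltr_distl.
  exists (pickle (\row_i q i)) => //; rewrite /F pickleK => i.
  by rewrite !mxE; exact: qP.
have : mu.-negligible (\bigcup_k F k).
  apply: negligible_bigcup => k; rewrite /F; case: unpickle => [q|]; last exact: negligible_set0.
  exists (cube (map_mx ratr q) e); split => //; first exact: cube_measurable.
  by rewrite -m0; exact: cube_shift.
rewrite FT => -[N [mN N0 TN]].
have NT : N = setT by apply/seteqP; split.
have : (\int[mu]_(x in setT) (W x)%:E = 0)%E.
  rewrite -NT; apply: null_set_integral => //.
  by apply/measurable_EFinP; apply: measurable_funTS; exact: measurable_weight.
by rewrite W1 => /eqP; rewrite eqe oner_eq0.
Qed.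

Lemma unit_ball_measurable (x : L) : measurable (unit_ball x).
Proof. by apply: measurable_borel_lebesgue; exact: measurable_borel_unit_ball. Qed.

Lemma unit_ball_fin (x : L) : (mu (unit_ball x) < +oo)%E.
Proof.
apply: (le_lt_trans _ (cube_fin x 1)); apply: le_measure; rewrite ?inE.
- exact: unit_ball_measurable.
- exact: cube_measurable.
- move=> y xy i; have := enorm_coord (y - x) i; rewrite !mxE.
  by move/le_lt_trans; apply.
Qed.

Lemma measurable_borel_sub (z : L) : measurable_fun setT ((fun x : L => z - x) : B -> B).
Proof.
apply: measurable_fun_borel_rVP => i.
apply: (eq_measurable_fun (fun x : B => z ord0 i - (x : L) ord0 i)).
  by move=> x _; rewrite !mxE.
by apply: measurable_funB => //; exact: measurable_borel_rV_coord.
Qed.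

(** Only z is removed; keeping F(-x) on the right makes translation invariance sufficient, with no
    appeal to invariance under reflection. *)
Lemma integral_reflect (F : L -> R) (z : L) :
  measurable_fun setT (F : B -> R) -> (forall x, 0 <= F x) ->
  (\int[mu]_x (F (z - x))%:E = \int[mu]_x (F (- x))%:E)%E.
Proof.
move=> mF F0.
have mN := measurableT_comp mF (measurable_borel_sub 0).
rewrite -(integral_lebesgue_shift (F := fun x => (F (- x))%:E) (- z)).
- by apply: eq_integral => x _; rewrite opprD opprK addrC.
- by apply/measurable_EFinP; apply: (eq_measurable_fun _ _ mN) => x _; rewrite /= sub0r.
- by move=> x; rewrite lee_fin.
Qed.

Lemma unit_ball_gt0 (x : L) : (0 < mu (unit_ball x))%E.
Proof.
apply: (lt_le_trans (cube_gt0 x (bump_radius_gt0 (d := d)))).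
apply: le_measure; rewrite ?inE.
- exact: cube_measurable.
- exact: unit_ball_measurable.
- move=> y xy; apply: cube_enorm => i; rewrite !mxE ltW// (lt_trans (xy i))//.
  by rewrite -bump_radiusD ltrDl bump_radius_gt0.
Qed.

Lemma unit_ballE (x : L) : mu (unit_ball x) = (\int[mu]_y (ball1 (x - y))%:E)%E.
Proof.
have <- : (\int[mu]_y (\1_(unit_ball x) y)%:E = mu (unit_ball x))%E.
  by rewrite integral_indic ?setIT//; exact: unit_ball_measurable.
apply: eq_integral => y _; congr (_%:E).
rewrite ball1E indicE enorm_distC; case: ifPn => h.
  by rewrite mem_set.
by rewrite memNset//; exact/negP.
Qed.

Lemma unit_ball_mass : exists2 m : R, 0 < m & forall x, mu (unit_ball x) = m%:E.
Proof.
have E x : mu (unit_ball x) = mu (unit_ball 0).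
  have r := integral_reflect _ (@measurable_borel_ball1 R d) (@ball1_ge0 R d).
  exact: (etrans (unit_ballE x) (etrans (r x) (esym (etrans (unit_ballE 0) (r 0))))).
have := unit_ball_gt0 0; have := unit_ball_fin 0.
case: (mu (unit_ball 0)) E => [m E _ m0|//|//].
by exists m.
Qed.

(** Positive because the bump is positive on a cube of positive measure, finite because it lies
    below the ball indicator. *)
Lemma bump_mass : exists2 m : R, 0 < m &
  forall z : L, (\int[mu]_x (bump_rV (z - x))%:E = m%:E)%E.
Proof.
have E (z : L) : (\int[mu]_x (bump_rV (z - x))%:E = \int[mu]_x (bump_rV (- x))%:E)%E.
  by apply: integral_reflect; [exact: measurable_borel_bump | exact: bump_rV_ge0].
have mb : measurable_fun setT (fun x : L => (bump_rV (- x))%:E).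
  have mb : measurable_fun setT ((fun x : L => bump_rV (0 - x)) : B -> R).
    exact: (measurableT_comp measurable_borel_bump (measurable_borel_sub 0)).
  apply/measurable_EFinP; apply: (eq_measurable_fun (fun x : L => bump_rV (0 - x))).
    by move=> x _; rewrite sub0r.
  exact: measurable_fun_borel_lebesgue.
have m0 : (0 < \int[mu]_x (bump_rV (- x : L))%:E)%E.
  rewrite lt_neqAle integral_ge0 ?andbT; last by move=> x _; rewrite lee_fin bump_rV_ge0.
  apply/eqP => /esym I0.
  have : (\int[mu]_x `|(bump_rV (- x : L))%:E| = 0)%E.
    by rewrite -I0; apply: eq_integral => x _; rewrite gee0_abs// lee_fin bump_rV_ge0.
  move/ae_eq_integral_abs => /(_ measurableT mb)[N [mN N0 sN]].
  have : (mu (cube 0 (@bump_radius R d)) <= mu N)%E.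
    apply: (@le_measure _ _ _ mu); rewrite ?inE//; first exact: cube_measurable.
    move=> x xc; apply: sN => /(_ Logic.I) /eqP; rewrite eqe gt_eqF// bump_rV_gt0//.
    by move=> i; have := xc i; rewrite !mxE !subr0 normrN.
  by rewrite [X in (_ <= X)%E]N0 leNgt cube_gt0// bump_radius_gt0.
have moo : (\int[mu]_x (bump_rV (- x : L))%:E < +oo)%E.
  apply: (le_lt_trans _ (unit_ball_fin 0)); rewrite unit_ballE.
  apply: ge0_le_integral => //.
  - by move=> x _; rewrite lee_fin bump_rV_ge0.
  - apply/measurable_EFinP; apply: measurable_fun_borel_lebesgue.
    apply: (measurableT_comp measurable_borel_ball1).
    exact: measurable_borel_sub.
  - by move=> x _; rewrite lee_fin sub0r bump_rV_le_ball1.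
move: m0 moo E; case: (\int[mu]_x _)%E => [m m0 _ E|//|//].
by exists m.
Qed.

End mass.

(** * Moving averages from the weight to the function *)

Lemma measurable_funZl d (T : measurableType d) (R : realType) (c : R) (f : T -> R) :
  measurable_fun setT f -> measurable_fun setT (fun x => c * f x).
Proof. by move=> mf; apply: measurable_funM. Qed.

Section energy.
Context {R : realType} {d : nat}.
Notation B := (borel_rV R d).
Notation L := 'rV[R]_d.
Notation mu := (lebesgue_rV R d).
Variable V : L -> R.
Hypothesis cW : continuous (weight V).
Notation W := (weight V).
Hypothesis W1 : (\int[mu]_x (W x)%:E = 1)%E.
Variable p : R.
Hypothesis p1 : 1 <= p.

Definition local_diff (u : L -> R) (x : L) : \bar R :=
  \int[mu]_(y in unit_ball x) (`|u x - u y| `^ p)%:E.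

(** The integral on the right-hand side of the theorem. *)
Definition energy (u : L -> R) : \bar R :=
  (\int[mu]_x (local_diff u x * (W x)%:E))%E.

Let mW : measurable_fun setT W := measurable_weight cW.
Let W0 x : 0 <= W x := ltW (weight_gt0 V x).

Lemma measurable_kernel (k : L -> R) : measurable_fun setT (k : B -> R) ->
  measurable_fun setT (fun q : L * L => k (q.2 - q.1)).
Proof. by move=> mk; exact: (measurableT_comp mk measurable_diff2). Qed.

Lemma measurable_kernel1 (k : L -> R) (z : L) : measurable_fun setT (k : B -> R) ->
  measurable_fun setT (fun x : L => k (z - x)).
Proof.
move=> mk; apply: measurable_fun_borel_lebesgue.
exact: (measurableT_comp mk (measurable_borel_sub z)).
Qed.

Lemma measurable_kernel2 (k : L -> R) (x : L) : measurable_fun setT (k : B -> R) ->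
  measurable_fun setT (fun z : L => k (z - x)).
Proof.
move=> mk; apply: measurable_fun_borel_lebesgue.
exact: (measurableT_comp mk (measurable_borel_shift (- x))).
Qed.

Lemma measurable_powR_dist (T : measurableType (lebesgue_rV_display)) (f g : T -> R) :
  measurable_fun setT f -> measurable_fun setT g ->
  measurable_fun setT (fun x => `|f x - g x| `^ p).
Proof.
move=> mf mg; apply: (measurableT_comp (measurable_powR p)).
by apply: measurableT_comp => //; exact: measurable_funB.
Qed.

Section one_function.
Variable u : L -> R.
Hypothesis mfu : measurable_fun setT u.

Lemma local_diffE x : local_diff u x =
  (\int[mu]_y (ball1 (x - y) * `|u x - u y| `^ p)%:E)%E.
Proof.
rewrite /local_diff integral_mkcond; apply: eq_integral => y _.
rewrite patchE ball1E enorm_distC; case: ifPn => [|/negP] h.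
  by move/set_mem : h => h; rewrite ifT ?mul1r.
by rewrite ifF ?mul0r//; apply/negP => h'; apply: h; rewrite inE.
Qed.

Lemma measurable_local_diff : measurable_fun setT (local_diff u).
Proof.
have -> : local_diff u = fubini_F mu
    (fun q : L * L => (ball1 (q.1 - q.2) * `|u q.1 - u q.2| `^ p)%:E).
  by apply/funext => x; rewrite local_diffE.
apply: measurable_fun_fubini_tonelli_F => [|q]; last first.
  by rewrite lee_fin mulr_ge0 ?ball1_ge0 ?powR_ge0.
apply/measurable_EFinP; apply: measurable_funM.
  have -> : (fun q : L * L => ball1 (q.1 - q.2)) = (fun q => ball1 (q.2 - q.1)).
    by apply/funext => q; rewrite !ball1E enorm_distC.
  by apply: measurable_kernel; exact: measurable_borel_ball1.
apply: (measurableT_comp (measurable_powR p)); apply: measurableT_comp => //.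
by apply: measurable_funB; [exact: (measurableT_comp mfu measurable_fst)|
  exact: (measurableT_comp mfu measurable_snd)].
Qed.

Lemma local_diff_ge0 x : (0 <= local_diff u x)%E.
Proof. by apply: integral_ge0 => y _; rewrite lee_fin powR_ge0. Qed.

Lemma energy_ge0 : (0 <= energy u)%E.
Proof.
by apply: integral_ge0 => x _; rewrite mule_ge0 ?local_diff_ge0// lee_fin.
Qed.

Hypothesis u0 : forall x, 0 <= u x.

Let mup : measurable_fun setT (fun x : L => u x `^ p).
Proof. exact: (measurableT_comp (measurable_powR p) mfu). Qed.

Let mloc (z : L) : measurable_fun setT (fun x : L => ball1 (z - x) * `|u z - u x| `^ p).
Proof.
apply: measurable_funM; last exact: measurable_powR_dist.
by apply: measurable_kernel1; exact: measurable_borel_ball1.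
Qed.

Section one_kernel.
Variables (k : L -> R) (M : R).
Hypothesis mk : measurable_fun setT (k : B -> R).
Hypothesis kM : forall v, 0 <= k v <= M * ball1 v.
Hypothesis M0 : 0 <= M.

Let k0 v : 0 <= k v. Proof. by case/andP: (kM v). Qed.

Variables (eps C : R).
Hypotheses (eps0 : 0 < eps) (C0 : 0 < C).
Hypothesis epsC : forall a b c, 0 <= a -> 0 <= b -> 0 <= c -> c <= a + b ->
    c `^ p <= (1 + eps) * a `^ p + C * b `^ p.

(** Apply [epsC] to u x <= u z + |u z - u x| and integrate against k(z - x). In the error term k is
    replaced by its bound M times the ball indicator, which yields [local_diff]. *)
Lemma kernel_avg_le (kb : R) z : (\int[mu]_x (k (z - x))%:E <= kb%:E)%E ->
  (\int[mu]_x (k (z - x) * u x `^ p)%:E <=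
   ((1 + eps) * kb)%:E * (u z `^ p)%:E + (C * M)%:E * local_diff u z)%E.
Proof.
move=> kbP; have mk1 := measurable_kernel1 z mk.
apply: (@le_trans _ _ (\int[mu]_x ((1 + eps) * u z `^ p * k (z - x) +
    C * M * (ball1 (z - x) * `|u z - u x| `^ p))%:E)%E).
  apply: le_integral_real.
  - exact: measurable_funM.
  - by apply: measurable_funD; exact: measurable_funM.
  - move=> x; rewrite mulr_ge0 ?powR_ge0//=.
    have ab : u x <= u z + `|u z - u x|.
      by rewrite -lerBlDl (le_trans (ler_norm _))// distrC.
    have /andP[_ kMx] := kM (z - x).
    have := epsC (u0 z) (normr_ge0 (u z - u x)) (u0 x) ab.
    move=> /(ler_wpM2l (k0 (z - x))) /le_trans; apply.
    rewrite mulrDr; apply: lerD; first by rewrite le_eqVlt; apply/orP; left; apply/eqP; ring.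
    apply: (@le_trans _ _ (M * ball1 (z - x) * (C * `|u z - u x| `^ p))).
      by apply: ler_wpM2r => //; rewrite mulr_ge0 ?powR_ge0// ltW.
    by rewrite le_eqVlt; apply/orP; left; apply/eqP; ring.
rewrite integralD_real; first last.
- by move=> x; rewrite !mulr_ge0 ?ball1_ge0 ?powR_ge0// ltW.
- by move=> x; rewrite !mulr_ge0 ?powR_ge0// addr_ge0// ltW.
- exact: measurable_funM.
- exact: measurable_funM.
rewrite integralZl_real//; last by rewrite mulr_ge0 ?powR_ge0// addr_ge0// ltW.
rewrite integralZl_real//; last 2 first.
- by move=> x; rewrite mulr_ge0 ?ball1_ge0 ?powR_ge0.
- by rewrite mulr_ge0// ltW.
rewrite -local_diffE; apply: leeD => //.
rewrite EFinM [X in (_ <= X * _)%E]EFinM -muleA -muleA.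
apply: lee_wpmul2l; first by rewrite lee_fin addr_ge0// ltW.
by rewrite [leRHS]muleC; apply: lee_wpmul2l; rewrite ?lee_fin ?powR_ge0.
Qed.

(** The same split with the two points exchanged, so that the mass of k multiplies u z ^ p on the
    smaller side. *)
Lemma kernel_avg_ge (kb : R) z : 0 <= kb -> (\int[mu]_x (k (z - x))%:E = kb%:E)%E ->
  (kb%:E * (u z `^ p)%:E <=
  (1 + eps)%:E * \int[mu]_x (k (z - x) * u x `^ p)%:E + (C * M)%:E * local_diff u z)%E.
Proof.
move=> kb0 kbP; have mk1 := measurable_kernel1 z mk.
have mku : measurable_fun setT (fun x : L => k (z - x) * u x `^ p) := measurable_funM mk1 mup.
have ku0 x : 0 <= k (z - x) * u x `^ p by rewrite mulr_ge0 ?powR_ge0.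
have l0 x : 0 <= ball1 (z - x) * `|u z - u x| `^ p.
  by rewrite mulr_ge0 ?ball1_ge0 ?powR_ge0.
have e0 : 0 <= 1 + eps by rewrite addr_ge0// ltW.
have CM0 : 0 <= C * M by rewrite mulr_ge0// ltW.
rewrite local_diffE -(integralZl_real mu mku ku0 e0) -(integralZl_real mu (mloc z) l0 CM0).
rewrite -integralD_real; first last.
- by move=> x; rewrite mulr_ge0.
- by move=> x; rewrite mulr_ge0.
- exact: (measurable_funZl _ (mloc z)).
- exact: (measurable_funZl _ mku).
rewrite -kbP muleC -(integralZl_real mu mk1 _ (powR_ge0 _ _)) => [|x]; last exact: k0.
apply: le_integral_real.
- exact: measurable_funZl.
- exact: (measurable_funD (measurable_funZl _ mku) (measurable_funZl _ (mloc z))).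
- move=> x; rewrite mulr_ge0 ?powR_ge0//=.
  have ab : u z <= u x + `|u z - u x| by rewrite -lerBlDl ler_norm.
  have /andP[_ kMx] := kM (z - x).
  have := epsC (u0 x) (normr_ge0 (u z - u x)) (u0 z) ab.
  move=> /(ler_wpM2r (k0 (z - x))) /le_trans; apply.
  rewrite mulrDl; apply: lerD; first by rewrite le_eqVlt; apply/orP; left; apply/eqP; ring.
  apply: (@le_trans _ _ (C * `|u z - u x| `^ p * (M * ball1 (z - x)))).
    by apply: ler_wpM2l => //; rewrite mulr_ge0 ?powR_ge0// ltW.
  by rewrite le_eqVlt; apply/orP; left; apply/eqP; ring.
Qed.

Definition kernel_energy : \bar R :=
  (\int[mu]_x ((u x `^ p)%:E * \int[mu]_z (k (z - x) * W z)%:E))%E.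

Lemma kernel_energyE : kernel_energy =
  (\int[mu]_z ((\int[mu]_x (k (z - x) * u x `^ p)%:E) * (W z)%:E))%E.
Proof.
pose f (q : L * L) : \bar R := (u q.1 `^ p * (k (q.2 - q.1) * W q.2))%:E.
transitivity (\int[mu]_x \int[mu]_z f (x, z))%E.
  apply: eq_integral => x _.
  have mkW : measurable_fun setT (fun z : L => k (z - x) * W z) :=
    measurable_funM (measurable_kernel2 x mk) mW.
  have kW0 z : 0 <= k (z - x) * W z by exact: mulr_ge0.
  exact: esym (integralZl_real mu mkW kW0 (powR_ge0 (u x) p)).
rewrite fubini_tonelli; first last.
- by move=> q; rewrite lee_fin !mulr_ge0 ?powR_ge0.
- apply/measurable_EFinP; apply: measurable_funM.
    exact: (measurableT_comp mup measurable_fst).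
  apply: measurable_funM; first exact: measurable_kernel.
  exact: (measurableT_comp mW measurable_snd).
apply: eq_integral => z _.
have mku : measurable_fun setT (fun x : L => k (z - x) * u x `^ p) :=
  measurable_funM (measurable_kernel1 z mk) mup.
rewrite muleC -(integralZl_real mu mku _ (W0 z)).
- by apply: eq_integral => x _; congr (_%:E); rewrite /=; ring.
- by move=> x; rewrite mulr_ge0 ?powR_ge0.
Qed.

Lemma measurable_kernel_avg : measurable_fun setT
  (fun z : L => \int[mu]_x (k (z - x) * u x `^ p)%:E)%E.
Proof.
apply: (measurable_fun_fubini_tonelli_G (m1 := mu)
  (fun q : L * L => (k (q.2 - q.1) * u q.1 `^ p)%:E)) => [|q].
  apply/measurable_EFinP; apply: measurable_funM; first exact: measurable_kernel.
  exact: (measurableT_comp mup measurable_fst).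
by rewrite lee_fin mulr_ge0 ?powR_ge0.
Qed.

Lemma measurable_kernel_weight : measurable_fun setT
  (fun x : L => \int[mu]_z (k (z - x) * W z)%:E)%E.
Proof.
apply: (measurable_fun_fubini_tonelli_F (m2 := mu)
  (fun q : L * L => (k (q.2 - q.1) * W q.2)%:E)) => [|q].
  apply/measurable_EFinP; apply: measurable_funM; first exact: measurable_kernel.
  exact: (measurableT_comp mW measurable_snd).
by rewrite lee_fin mulr_ge0.
Qed.

Let mWE : measurable_fun setT (fun x : L => (W x)%:E).
Proof. exact/measurable_EFinP. Qed.

Let mupW : measurable_fun setT (fun x : L => u x `^ p * W x).
Proof. exact: (measurable_funM mup mW). Qed.

Let mlocW : measurable_fun setT (fun x : L => local_diff u x * (W x)%:E)%E.
Proof. exact: (emeasurable_funM measurable_local_diff mWE). Qed.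

Let mavgW : measurable_fun setT
  (fun z : L => (\int[mu]_x (k (z - x) * u x `^ p)%:E) * (W z)%:E)%E.
Proof. exact: (emeasurable_funM measurable_kernel_avg mWE). Qed.

Let upW0 x : 0 <= u x `^ p * W x. Proof. by rewrite mulr_ge0 ?powR_ge0. Qed.

Let avg0 z : (0 <= \int[mu]_x (k (z - x) * u x `^ p)%:E)%E.
Proof. by apply: integral_ge0 => x _; rewrite lee_fin mulr_ge0 ?powR_ge0. Qed.

Lemma kernel_energy_le (kb : R) : 0 <= kb ->
  (forall z, (\int[mu]_x (k (z - x))%:E <= kb%:E)%E) ->
  (kernel_energy <= ((1 + eps) * kb)%:E * \int[mu]_x (u x `^ p * W x)%:E +
    (C * M)%:E * energy u)%E.
Proof.
move=> kb0 kbP; have e0 : 0 <= (1 + eps) * kb by rewrite mulr_ge0// addr_ge0// ltW.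
have CM0 : 0 <= C * M by rewrite mulr_ge0// ltW.
rewrite kernel_energyE -(integralZl_real mu mupW upW0 e0).
rewrite /energy -ge0_integralZl//; last first.
  by move=> x _; rewrite mule_ge0 ?local_diff_ge0 ?lee_fin.
have mA : measurable_fun setT (fun x : L => ((1 + eps) * kb * (u x `^ p * W x))%:E).
  by apply/measurable_EFinP; exact: measurable_funZl.
have mB : measurable_fun setT (fun x : L => (C * M)%:E * (local_diff u x * (W x)%:E))%E.
  exact: (emeasurable_funM _ mlocW).
rewrite -ge0_integralD//; first last.
- by move=> x _; rewrite !mule_ge0 ?local_diff_ge0 ?lee_fin.
- by move=> x _; rewrite lee_fin mulr_ge0.
apply: (ge0_le_integral _ measurableT).
- by move=> z _; rewrite mule_ge0 ?lee_fin.
- exact: mavgW.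
- exact: (emeasurable_funD mA mB).
- move=> z _; rewrite mulrA !EFinM muleA -ge0_muleDl.
  + by apply: lee_wpmul2r; rewrite ?lee_fin// -EFinM -EFinM; exact: kernel_avg_le.
  + by rewrite mule_ge0 ?lee_fin ?powR_ge0.
  + by rewrite -EFinM mule_ge0 ?lee_fin ?local_diff_ge0.
Qed.

Lemma kernel_energy_ge (kb : R) : 0 <= kb ->
  (forall z, (\int[mu]_x (k (z - x))%:E = kb%:E)%E) ->
  (kb%:E * \int[mu]_x (u x `^ p * W x)%:E <=
    (1 + eps)%:E * kernel_energy + (C * M)%:E * energy u)%E.
Proof.
move=> kb0 kbP; have e0 : 0 <= 1 + eps by rewrite addr_ge0// ltW.
have CM0 : 0 <= C * M by rewrite mulr_ge0// ltW.
rewrite kernel_energyE -(integralZl_real mu mupW upW0 kb0).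
rewrite /energy -ge0_integralZl//; last first.
  by move=> x _; rewrite mule_ge0 ?lee_fin.
rewrite -ge0_integralZl//; last first.
  by move=> x _; rewrite mule_ge0 ?local_diff_ge0 ?lee_fin.
have mB : measurable_fun setT (fun x : L => (C * M)%:E * (local_diff u x * (W x)%:E))%E.
  exact: (emeasurable_funM _ mlocW).
have mA : measurable_fun setT (fun z : L =>
    (1 + eps)%:E * ((\int[mu]_x (k (z - x) * u x `^ p)%:E) * (W z)%:E))%E.
  exact: (emeasurable_funM _ mavgW).
rewrite -ge0_integralD//; first last.
- by move=> x _; rewrite !mule_ge0 ?local_diff_ge0 ?lee_fin.
- by move=> x _; rewrite !mule_ge0 ?lee_fin.
apply: (ge0_le_integral _ measurableT).
- by move=> z _; rewrite lee_fin mulr_ge0.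
- by apply/measurable_EFinP; exact: measurable_funZl.
- exact: (emeasurable_funD mA mB).
- move=> z _; rewrite mulrA EFinM !muleA -ge0_muleDl.
  + by apply: lee_wpmul2r; rewrite ?lee_fin// EFinM; exact: kernel_avg_ge.
  + by rewrite mule_ge0 ?lee_fin.
  + by rewrite mule_ge0 ?lee_fin ?local_diff_ge0.
Qed.

End one_kernel.

End one_function.

End energy.

(** * The averaged Laplacian inequality *)

Section lyapunov.
Context {R : realType} {d : nat}.
Notation B := (borel_rV R d).
Notation L := 'rV[R]_d.
Notation mu := (lebesgue_rV R d).
Local Notation e_ i := (delta_mx ord0 i : L).
Local Notation eta := (@bump_radius R d).
Variable V : L -> R.
Hypothesis hV : C2 V.
Notation W := (weight V).
Hypothesis W1 : (\int[mu]_x (W x)%:E = 1)%E.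
Variables (s rho r : R).
Hypotheses (s01 : 0 < s < 1) (rho0 : 0 < rho).
Hypothesis hL : forall x, r < enorm x ->
  rho <= s * enorm (grad V x) ^+ 2 - laplacian V x.

Let cW : continuous W := continuous_weight hV.
Let mWB : measurable_fun setT (W : B -> R) := continuous_measurable_borel cW.
Let mW : measurable_fun setT W := measurable_weight cW.
Let W0 x : 0 <= W x := ltW (weight_gt0 V x).

(** The margin 2 exceeds [eta], so the closed cube of radius [eta] around x stays where the
    hypothesis on V applies; its compactness gives one threshold on h for all its points. *)
Lemma weight_laplacian_near (x : L) : ~ cube 0 (r + 2) x ->
  \forall h \near 0^'+, forall z, cube x eta z ->
    (2 * d%:R + rho / 2 * h ^+ 2) * W z <=
    \sum_i (W (z + h *: e_ i) + W (z - h *: e_ i)).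
Proof.
move=> xr.
have [i0 xi0] : exists i, r + 2 <= `|x ord0 i|.
  apply: contrapT => /forallNP hj; apply: xr => j; rewrite mxE subr0.
  by case: (leP (r + 2) `|x ord0 j|) => [/hj|].
have /compact_near_coveringP cK := @compact_closed_cube R d x eta.
suff H : \forall h \near 0^'+, [set z : L | forall i, `|z ord0 i - x ord0 i| <= eta] `<=`
   (fun z => (2 * d%:R + rho / 2 * h ^+ 2) * W z <=
    \sum_i (W (z + h *: e_ i) + W (z - h *: e_ i))).
  by apply: filterS H => h H z xz; apply: H => i; rewrite ltW.
apply: cK => z /= zx.
have rz : r < enorm z.
  apply: lt_le_trans (enorm_coord z i0); have := zx i0.
  have /andP[_ eta1] := @bump_radius_le1 R d.
  have := lerB_dist (x ord0 i0) (x ord0 i0 - z ord0 i0); rewrite opprB addrCA subrr addr0.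
  rewrite (distrC (x ord0 i0)); lra.
have ge := sum_weight_dd_ge s01 hL rz.
have Wz := weight_gt0 V z.
(* The d errors together cost at most rho W z / 4, and W y < 3/2 W z bounds rho / 2 W y by 3/4 rho W
   z. Their sum is exactly the available rho W z, which explains the factor rho / 2. *)
pose eps := rho * W z / (4 * d.+1%:R).
have eps0 : 0 < eps by rewrite divr_gt0 ?mulr_gt0.
have FF : Filter (filter_prod (nbhs z) (nbhs (0:R)^'+)) by exact: filter_prod_filter.
have N1 := filter_forall FF (fun i => weight_second_difference_near hV i z eps0).
have N2 : \forall y \near z & h \near (0:R)^'+, W y < 3 / 2 * W z.
  have : \forall y \near z, W y < 3 / 2 * W z.
    have /cvgrPdist_lt/(_ _ (divr_gt0 Wz (ltr0n _ 2))) H : W y @[y --> z] --> W z.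
      exact: cW.
    near=> y; have : `|W z - W y| < W z / 2 by near: y.
    by rewrite ltr_norml => /andP[]; lra.
  move=> H; exists ([set y | W y < 3 / 2 * W z], setT) => /=; first by split=> //; exact: filterT.
  by move=> [y h] [].
apply: filterS2 N1 N2 => -[y h] /= N1 N2.
apply: le_trans (ler_sum _ (fun i _ => N1 i)).
rewrite big_split/= -mulr_sumr sumrB !sumr_const card_ord.
move: ge; set S := \sum_i weight_dd V i z => ge.
rewrite -(mulr_natr eps) -(mulr_natr (2 * _)).
have de : eps * d%:R <= rho * W z / 4.
  rewrite /eps invfM mulrA -mulrA ler_piMr ?mulr_ge0 ?invr_ge0 ?(ltW rho0)//.
  by rewrite mulrC ler_pdivrMr// mul1r ler_nat.
have rW : rho * W y <= rho * (3 / 2 * W z) by rewrite ler_pM2l// ltW.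
have k : 0 <= h ^+ 2 * (S - eps * d%:R - rho / 2 * W y).
  by rewrite mulr_ge0 ?sqr_ge0//; lra.
lra.
Unshelve. all: by end_near. Qed.

Local Notation Mk := (@kappa_bound R d).

(** It has the ball term of [kappa h]; rho / 2 times the bump stands where [kappa h] has its scaled
    second difference. *)
Definition kernel0 (v : L) : R := Mk * ball1 v + rho / 2 * bump_rV v.

Lemma measurable_kernel0 : measurable_fun setT (kernel0 : B -> R).
Proof.
apply: measurable_funD; apply: measurable_funZl.
  exact: measurable_borel_ball1.
exact: measurable_borel_bump.
Qed.

Lemma kernel0_bounds v : 0 <= kernel0 v <= (Mk + rho / 2) * ball1 v.
Proof.
have b0 := bump_rV_ge0 v; have bb := bump_rV_le_ball1 v; have l0 := ball1_ge0 v.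
have M0 := @kappa_bound_ge0 R d.
apply/andP; split; rewrite /kernel0.
  by rewrite addr_ge0 ?mulr_ge0 ?divr_ge0// ltW.
by rewrite mulrDl lerD2l ler_wpM2l// divr_ge0// ltW.
Qed.

Let cv (k : L -> R) (x : L) : \bar R := (\int[mu]_z (k (z - x) * W z)%:E)%E.

Let mkW (k : L -> R) (x : L) : measurable_fun setT (k : B -> R) ->
  measurable_fun setT (fun z : L => k (z - x) * W z).
Proof. by move=> mk; exact: (measurable_funM (measurable_kernel2 x mk) mW). Qed.

Let cvD (k1 k2 : L -> R) (a b : R) (x : L) : measurable_fun setT (k1 : B -> R) ->
  measurable_fun setT (k2 : B -> R) -> (forall v, 0 <= k1 v) -> (forall v, 0 <= k2 v) ->
  0 <= a -> 0 <= b ->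
  (cv (fun v => a * k1 v + b * k2 v)%R x = a%:E * cv k1 x + b%:E * cv k2 x)%E.
Proof.
move=> m1 m2 k10 k20 a0 b0.
have p1 z : 0 <= k1 (z - x) * W z by rewrite mulr_ge0.
have p2 z : 0 <= k2 (z - x) * W z by rewrite mulr_ge0.
rewrite -(integralZl_real mu (mkW x m1) p1 a0) -(integralZl_real mu (mkW x m2) p2 b0).
rewrite -(integralD_real mu (measurable_funZl a (mkW x m1)) (measurable_funZl b (mkW x m2))).
- by apply: eq_integral => z _; congr (_%:E); ring.
- by move=> z; rewrite mulr_ge0.
- by move=> z; rewrite mulr_ge0.
Qed.

Lemma shift_bump_weight (x v : L) :
  (\int[mu]_z (bump_rV (z - x + v)%R * W z)%:E =
   \int[mu]_z (bump_rV (z - x)%R * W (z - v)%R)%:E)%E.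
Proof.
rewrite -(integral_lebesgue_shift (F := fun t => (bump_rV (t - x) * W (t - v))%:E) v).
- by apply: eq_integral => z _; rewrite addrK addrAC.
- apply/measurable_EFinP; apply: measurable_funM.
    exact: (measurableT_comp measurable_borel_bump (measurable_borel_shift _)).
  exact: (measurableT_comp mWB (measurable_borel_shift _)).
- by move=> z; rewrite lee_fin mulr_ge0 ?bump_rV_ge0.
Qed.

(** A summation by parts: translation carries the second difference from the bump to W, where
    [weight_laplacian_near] applies on the support of the bump. Off that support both bump terms
    vanish. *)
Lemma kernel0_le_kappa_near (x : L) : ~ cube 0 (r + 2) x ->
  \forall h \near 0^'+, (cv kernel0 x <= cv (kappa h) x)%E.
Proof.
move=> xr; near=> h.
have h0 : 0 < h by near: h; exact: nbhs_right_gt.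
have heta : h <= eta by near: h; apply: nbhs_right_le; exact: bump_radius_gt0.
have hW : forall z, cube x eta z ->
    (2 * d%:R + rho / 2 * h ^+ 2) * W z <= \sum_i (W (z + h *: e_ i) + W (z - h *: e_ i)).
  by near: h; exact: weight_laplacian_near.
have mb := @measurable_borel_bump R d; have b0 := @bump_rV_ge0 R d.
have mk h' := @measurable_borel_kappa R d h'.
have hh : 0 < h <= eta by rewrite h0.
have k0 (v : L) : 0 <= kappa h v by have /andP[] := kappa_bounds v hh.
have k00 (v : L) : 0 <= kernel0 v by case/andP: (kernel0_bounds v).
have h20 := sqr_ge0 h.
have d0 : 0 <= 2 * d%:R :> R by rewrite mulr_ge0.
(* This term is added to both sides to bring in the subtraction-free form [kappaE], and must be
   finite to be cancelled. *)
have bfin : ((2 * d%:R)%:E * cv bump_rV x)%E \is a fin_num.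
  rewrite fin_numM// ge0_fin_numE; last first.
    by apply: integral_ge0 => z _; rewrite lee_fin mulr_ge0.
  apply: (@le_lt_trans _ _ 1%E); last exact: ltry.
  rewrite -W1; apply: (le_integral_real mu (mkW x mb) mW) => z.
  by rewrite mulr_ge0//= ler_piMl// bump_rV_le1.
suff: ((h ^+ 2)%:E * cv kernel0 x + (2 * d%:R)%:E * cv bump_rV x <=
    (h ^+ 2)%:E * cv (kappa h) x + (2 * d%:R)%:E * cv bump_rV x)%E.
  by rewrite leeD2rE// lee_pmul2l// lte_fin exprn_gt0.
rewrite -!cvD//; last exact: measurable_kernel0.
(* In [S] the bump is shifted, in [S'] the weight; the integrals agree term by term. *)
pose S z := \sum_i (bump_rV (z - x + h *: e_ i) * W z + bump_rV (z - x + - (h *: e_ i)) * W z).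
pose S' z := \sum_i (bump_rV (z - x) * W (z - h *: e_ i) + bump_rV (z - x) * W (z - - (h *: e_ i))).
have mball := mkW x (@measurable_borel_ball1 R d).
have mSi (v : L) : measurable_fun setT (fun z : L => bump_rV (z - x + v) * W z).
  apply: (measurable_funM _ mW); apply: measurable_fun_borel_lebesgue.
  exact: (measurableT_comp (measurableT_comp mb (measurable_borel_shift v)) (measurable_borel_shift (- x))).
have mS'i (v : L) : measurable_fun setT (fun z : L => bump_rV (z - x) * W (z - v)).
  apply: measurable_funM; first exact: measurable_kernel2.
  apply: measurable_fun_borel_lebesgue.
  exact: (measurableT_comp mWB (measurable_borel_shift (- v))).
have mT (i : 'I_d) : measurable_fun setT (fun z : L =>
    bump_rV (z - x + h *: e_ i) * W z + bump_rV (z - x + - (h *: e_ i)) * W z).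
  exact: (measurable_funD (mSi _) (mSi _)).
have mT' (i : 'I_d) : measurable_fun setT (fun z : L =>
    bump_rV (z - x) * W (z - h *: e_ i) + bump_rV (z - x) * W (z - - (h *: e_ i))).
  exact: (measurable_funD (mS'i _) (mS'i _)).
have bW0 (y z : L) : 0 <= bump_rV y * W z by rewrite mulr_ge0.
have SS' : (\int[mu]_z (S z)%:E = \int[mu]_z (S' z)%:E)%E.
  rewrite (integral_sum_real mu _ mT) => [|i z]; last exact: addr_ge0.
  rewrite (integral_sum_real mu _ mT') => [|i z]; last exact: addr_ge0.
  apply: eq_bigr => i _.
  have D1 := integralD_real mu (mSi (h *: e_ i)) (mSi (- (h *: e_ i)))
    (fun z => bW0 _ _) (fun z => bW0 _ _).
  have D2 := integralD_real mu (mS'i (h *: e_ i)) (mS'i (- (h *: e_ i)))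
    (fun z => bW0 _ _) (fun z => bW0 _ _).
  refine (etrans D1 (etrans _ (esym D2))).
  exact: (f_equal2 adde (shift_bump_weight x (h *: e_ i)) (shift_bump_weight x (- (h *: e_ i)))).
have S0 z : 0 <= S z by apply: sumr_ge0 => i _; rewrite addr_ge0// mulr_ge0.
have S'0 z : 0 <= S' z by apply: sumr_ge0 => i _; rewrite addr_ge0// mulr_ge0.
have mS : measurable_fun setT S := measurable_sum _ mT.
have mS' : measurable_fun setT S' := measurable_sum _ mT'.
have M0 := @kappa_bound_ge0 R d.
have l0 z : 0 <= h ^+ 2 * Mk * (ball1 (z - x) * W z).
  by rewrite mulr_ge0 ?mulr_ge0 ?ball1_ge0.
rewrite [leRHS](_ : _ = \int[mu]_z (h ^+ 2 * Mk * (ball1 (z - x) * W z) + S z)%:E)%E; last first.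
  apply: eq_integral => z _; congr (_%:E).
  have -> : S z = (\sum_i (bump_rV (z - x + h *: e_ i) + bump_rV (z - x - h *: e_ i))) * W z.
    by rewrite mulr_suml; apply: eq_bigr => i _; rewrite mulrDl.
  rewrite [in LHS]kappaE ?(gt_eqF h0)//; ring.
rewrite (integralD_real mu (measurable_funZl _ mball) mS l0 S0) SS'.
rewrite -(integralD_real mu (measurable_funZl _ mball) mS' l0 S'0).
have mb2 := measurable_funZl (2 * d%:R) mb.
have m02 := measurable_funZl (h ^+ 2) measurable_kernel0.
apply: (le_integral_real mu (mkW x (measurable_funD m02 mb2))
  (measurable_funD (measurable_funZl _ mball) mS')).
- move=> z; rewrite mulr_ge0 ?addr_ge0 ?mulr_ge0//=.
  suff : (2 * d%:R + rho / 2 * h ^+ 2) * W z * bump_rV (z - x) <= S' z.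
    by rewrite /kernel0; lra.
  have -> : S' z = (\sum_i (W (z + h *: e_ i) + W (z - h *: e_ i))) * bump_rV (z - x).
    rewrite /S' mulr_suml; apply: eq_bigr => i _; rewrite opprK; ring.
  have [zx|zx] := pselect (cube x eta z); first by rewrite ler_wpM2r ?hW.
  have [i zi] : exists i, eta <= `|z ord0 i - x ord0 i|.
    apply: contrapT => /forallNP hj; apply: zx => j.
    by case: (leP eta `|z ord0 j - x ord0 j|) => [/hj|].
  by rewrite (@bump_rV_eq0 _ _ _ i) ?mulr0// !mxE.
Unshelve. all: by end_near. Qed.

End lyapunov.

(** * The Lyapunov inequality for bounded functions *)

(** Fatou's lemma for the lower limit of g: the index from which f <= g n holds may depend on the
    point, and g need not converge. *)
Lemma integral_le_eventually d (T : measurableType d) (R : realType)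
    (mu : {measure set T -> \bar R}) (D : set T) (f : T -> \bar R)
    (g : nat -> T -> \bar R) (c : \bar R) : measurable D ->
  measurable_fun D f -> (forall n, measurable_fun D (g n)) ->
  (forall x, D x -> 0 <= f x)%E -> (forall n x, D x -> 0 <= g n x)%E ->
  (forall x, D x -> \forall n \near \oo, (f x <= g n x)%E) ->
  (forall n, \int[mu]_(x in D) g n x <= c)%E ->
  (\int[mu]_(x in D) f x <= c)%E.
Proof.
move=> mD mf mg f0 g0 fg gc.
apply: (@le_trans _ _ (\int[mu]_(x in D) limn_einf (g^~ x))%E).
  apply: (ge0_le_integral mu mD f0 mf).
    apply: (measurableT_comp (@oppe_measurable R setT)).
    apply: measurable_fun_limn_esup => n.
    exact: (measurableT_comp (@oppe_measurable R setT) (mg n)).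
  move=> x Dx; rewrite limn_einf_lim; apply: lime_ge; first exact: is_cvg_einfs.
  have [N _ fgN] := fg x Dx; exists N => // n /= Nn.
  by apply: le_ereal_inf_tmp => _ [k /= nk] <-; apply: fgN => /=; exact: leq_trans nk.
apply: (le_trans (fatou mu mD mg g0)).
rewrite limn_einf_lim; apply: lime_le; first exact: is_cvg_einfs.
apply: nearW => n; apply: le_trans (gc n).
by apply: ereal_inf_lbound; exists n => /=.
Qed.

Section lyapunov2.
Context {R : realType} {d : nat}.
Notation B := (borel_rV R d).
Notation L := 'rV[R]_d.
Notation mu := (lebesgue_rV R d).
Local Notation e_ i := (delta_mx ord0 i : L).
Local Notation eta := (@bump_radius R d).
Local Notation Mk := (@kappa_bound R d).
Variable V : L -> R.
Hypothesis hV : C2 V.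
Notation W := (weight V).
Hypothesis W1 : (\int[mu]_x (W x)%:E = 1)%E.
Variables (s rho r : R).
Hypotheses (s01 : 0 < s < 1) (rho0 : 0 < rho).
Hypothesis hL : forall x, r < enorm x ->
  rho <= s * enorm (grad V x) ^+ 2 - laplacian V x.
Variable p : R.
Hypothesis p1 : 1 <= p.

Let cW : continuous W := continuous_weight hV.
Let mW : measurable_fun setT W := measurable_weight cW.
Let W0 x : 0 <= W x := ltW (weight_gt0 V x).
Let mb := @measurable_borel_bump R d.
Let ml := @measurable_borel_ball1 R d.
Let b0 := @bump_rV_ge0 R d.
Let l0 := @ball1_ge0 R d.
Let M0 := @kappa_bound_ge0 R d.

Variables (m psi : R).
Hypotheses (m0 : 0 < m) (psi0 : 0 < psi).
Hypothesis mE : forall x : L, mu (unit_ball x) = m%:E.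
Hypothesis psiE : forall z : L, (\int[mu]_x (bump_rV (z - x))%:E = psi%:E)%E.

Let ballE (z : L) : (\int[mu]_x (ball1 (z - x))%:E = m%:E)%E.
Proof. by rewrite -unit_ballE mE. Qed.

Lemma integral_kernel0 (z : L) :
  (\int[mu]_x (kernel0 rho (z - x))%:E = (Mk * m + rho / 2 * psi)%:E)%E.
Proof.
have r2 : 0 <= rho / 2 by rewrite divr_ge0// ltW.
have ml1 := measurable_kernel1 z ml; have mb1 := measurable_kernel1 z mb.
rewrite (integralD_real mu (measurable_funZl Mk ml1) (measurable_funZl (rho / 2) mb1)).
- rewrite (integralZl_real mu ml1 (fun x => l0 _) M0) ballE.
  by rewrite (integralZl_real mu mb1 (fun x => b0 _) r2) psiE.
- by move=> x; exact: mulr_ge0.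
- by move=> x; exact: mulr_ge0.
Qed.

(** Every shifted bump has mass psi, so the second differences contribute nothing and only the ball
    term remains. *)
Lemma integral_kappa (h : R) (z : L) : 0 < h <= eta ->
  (\int[mu]_x (kappa h (z - x))%:E <= (Mk * m)%:E)%E.
Proof.
move=> hh; have h0 : 0 < h by case/andP: hh.
have k0 (v : L) : 0 <= kappa h v by have /andP[] := kappa_bounds v hh.
have h20 : 0 <= h ^+ 2 by exact: sqr_ge0.
have h2M : 0 <= h ^+ 2 * Mk by exact: mulr_ge0.
have d0 : 0 <= 2 * d%:R :> R by rewrite mulr_ge0.
have mk1 := measurable_kernel1 z (@measurable_borel_kappa R d h).
have ml1 := measurable_kernel1 z ml; have mb1 := measurable_kernel1 z mb.
have mbs (v : L) : measurable_fun setT (fun x : L => bump_rV (z - x + v)).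
  apply: (eq_measurable_fun (fun x : L => bump_rV (z + v - x))).
    by move=> x _; rewrite addrAC.
  exact: measurable_kernel1.
have bsE (v : L) : (\int[mu]_x (bump_rV (z - x + v))%:E = psi%:E)%E.
  by rewrite -(psiE (z + v)); apply: eq_integral => x _; rewrite addrAC.
have mT (i : 'I_d) : measurable_fun setT (fun x : L =>
    bump_rV (z - x + h *: e_ i) + bump_rV (z - x + - (h *: e_ i))).
  exact: (measurable_funD (mbs _) (mbs _)).
have T0 (i : 'I_d) (x : L) : 0 <= bump_rV (z - x + h *: e_ i) + bump_rV (z - x + - (h *: e_ i)).
  exact: addr_ge0.
have E : ((h ^+ 2)%:E * \int[mu]_x (kappa h (z - x))%:E + (2 * d%:R * psi)%:E =
    (h ^+ 2 * Mk * m)%:E + (2 * d%:R * psi)%:E)%E.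
  have pE : ((2 * d%:R * psi)%:E = \int[mu]_x (2 * d%:R * bump_rV (z - x))%:E)%E.
    by rewrite (integralZl_real mu mb1 (fun x => b0 _) d0) psiE.
  rewrite {1}pE -(integralZl_real mu mk1 (fun x => k0 _) h20).
  rewrite -(integralD_real mu (measurable_funZl _ mk1) (measurable_funZl _ mb1)); first last.
  - by move=> x; exact: mulr_ge0.
  - by move=> x; exact: mulr_ge0.
  transitivity (\int[mu]_x (h ^+ 2 * Mk * ball1 (z - x) +
      \sum_i (bump_rV (z - x + h *: e_ i) + bump_rV (z - x + - (h *: e_ i))))%:E)%E.
    by apply: eq_integral => x _; rewrite kappaE// gt_eqF.
  rewrite (integralD_real mu (measurable_funZl _ ml1) (measurable_sum _ mT)); first last.
  - by move=> x; apply: sumr_ge0 => i _; exact: T0.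
  - by move=> x; exact: mulr_ge0.
  rewrite (integralZl_real mu ml1 (fun x => l0 _) h2M) ballE -EFinM; congr (_ + _)%E.
  rewrite (integral_sum_real mu _ mT T0).
  transitivity (\sum_(i < d) (2 * psi)%:E)%E.
    apply: eq_bigr => i _.
    rewrite (integralD_real mu (mbs (h *: e_ i)) (mbs (- (h *: e_ i))) (fun x => b0 _) (fun x => b0 _)).
    by rewrite !bsE -EFinD; congr (_%:E); ring.
  by rewrite sumEFin sumr_const card_ord; congr (_%:E); rewrite -mulr_natr; ring.
have {}E : ((h ^+ 2)%:E * \int[mu]_x (kappa h (z - x))%:E + (2 * d%:R * psi)%:E <=
    (h ^+ 2)%:E * (Mk * m)%:E + (2 * d%:R * psi)%:E)%E.
  rewrite E le_eqVlt; apply/orP; left; apply/eqP; congr (_ + _)%E.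
  by rewrite -(mulrA (h ^+ 2)) EFinM.
by move: E; rewrite leeD2rE// lee_pmul2l// lte_fin exprn_gt0.
Qed.

Section bounded_function.
Variable u : L -> R.
Hypothesis mfu : measurable_fun setT u.
Hypothesis u0 : forall x, 0 <= u x.
Variables (eps C : R).
Hypotheses (eps0 : 0 < eps) (C0 : 0 < C).
Hypothesis epsC : forall a b c, 0 <= a -> 0 <= b -> 0 <= c -> c <= a + b ->
    c `^ p <= (1 + eps) * a `^ p + C * b `^ p.

Notation K := (cube (0 : L) (r + 2)).
Notation In := (\int[mu]_x (u x `^ p * W x)%:E)%E.
Notation Qn := (\int[mu]_(x in K) (u x `^ p)%:E)%E.
Notation En := (energy V p u).
Let k0 := @kernel0 R d rho.
Let a := Mk * m.
Let b := Mk * m + rho / 2 * psi.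
Let M' := Mk + rho / 2.

Let M'0 : 0 <= M'. Proof. by rewrite addr_ge0// divr_ge0// ltW. Qed.
Let a0 : 0 <= a. Proof. by rewrite mulr_ge0// ltW. Qed.
Let mup : measurable_fun setT (fun x : L => (u x `^ p)%:E).
Proof. by apply/measurable_EFinP; exact: (measurableT_comp (measurable_powR p) mfu). Qed.
Let up0 (x : L) : (0 <= (u x `^ p)%:E)%E. Proof. by rewrite lee_fin powR_ge0. Qed.

Let conv_ge0 (k : L -> R) (M : R) : (forall v, 0 <= k v <= M * ball1 v) ->
  forall x, (0 <= \int[mu]_z (k (z - x) * W z)%:E)%E.
Proof.
move=> kM x; apply: integral_ge0 => z _; rewrite lee_fin mulr_ge0//.
by case/andP: (kM (z - x)).
Qed.

Let mconv (k : L -> R) (M : R) : measurable_fun setT (k : B -> R) ->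
  (forall v, 0 <= k v <= M * ball1 v) ->
  measurable_fun setT (fun x : L => (u x `^ p)%:E * \int[mu]_z (k (z - x) * W z)%:E)%E.
Proof.
by move=> mk kM; apply: (emeasurable_funM mup); exact: (measurable_kernel_weight cW mk kM).
Qed.

Let mkernel0 : measurable_fun setT (k0 : B -> R).
Proof. exact: measurable_kernel0. Qed.

Let kernel0M (v : L) : 0 <= k0 v <= M' * ball1 v.
Proof. exact: kernel0_bounds. Qed.

(** On K nothing is known about the Laplacian; the average of W is bounded by the supremum M' of the
    kernel times the total mass 1. *)
Lemma kernel0_energy_inner :
  (\int[mu]_(x in K) ((u x `^ p)%:E * \int[mu]_z (k0 (z - x) * W z)%:E) <= M'%:E * Qn)%E.
Proof.
have mK := cube_measurable (0 : L) (r + 2).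
rewrite -(ge0_integralZl mu mK); last 3 first.
- exact: (measurable_funS measurableT (@subsetT _ _) mup).
- by move=> x _; exact: up0.
- by rewrite lee_fin.
apply: (ge0_le_integral _ mK).
- by move=> x _; apply: mule_ge0; [exact: up0 | exact: (conv_ge0 kernel0M)].
- exact: (measurable_funS measurableT (@subsetT _ _) (mconv mkernel0 kernel0M)).
- apply: (measurable_funS measurableT (@subsetT _ _)).
  exact: (emeasurable_funM (measurable_cst _) mup).
- move=> x _; rewrite muleC; apply: lee_wpmul2r; first exact: up0.
  apply: (@le_trans _ _ (\int[mu]_z (M' * W z)%:E)%E); last first.
    by rewrite (integralZl_real mu mW W0 M'0) W1 mule1.
  have mkW : measurable_fun setT (fun z : L => k0 (z - x) * W z).
    exact: (measurable_funM (measurable_kernel2 x mkernel0) mW).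
  apply: (le_integral_real mu mkW (measurable_funZl M' mW)) => z.
  have /andP[k1 k2] := kernel0M (z - x); rewrite mulr_ge0//= ler_wpM2r//.
  by rewrite (le_trans k2)// ler_piMr// ball1_le1.
Qed.

(** Along h n = eta / (n + 1) each point of the complement eventually satisfies the comparison of
    kernels, and the bounds on [kappa (h n)] do not depend on n. *)
Lemma kernel0_energy_outer :
  (\int[mu]_(x in ~` K) ((u x `^ p)%:E * \int[mu]_z (k0 (z - x) * W z)%:E) <=
   ((1 + eps) * a)%:E * In + (C * (2 * Mk))%:E * En)%E.
Proof.
have mK : measurable (~` K) := measurableC (cube_measurable (0 : L) (r + 2)).
pose h (n : nat) : R := eta / n.+1%:R.
have hh n : 0 < h n <= eta.
  by rewrite divr_gt0 ?bump_radius_gt0//= ler_pdivrMr// ler_pMr ?bump_radius_gt0// ler1n.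
have kM n (v : L) : 0 <= kappa (h n) v <= 2 * Mk * ball1 v := kappa_bounds v (hh n).
have mk n := @measurable_borel_kappa R d (h n).
apply: (@integral_le_eventually _ _ _ mu _ _
  (fun n x => (u x `^ p)%:E * \int[mu]_z (kappa (h n) (z - x) * W z)%:E)%E _ mK).
- exact: (measurable_funS measurableT (@subsetT _ _) (mconv mkernel0 kernel0M)).
- move=> n; exact: (measurable_funS measurableT (@subsetT _ _) (mconv (mk n) (kM n))).
- by move=> x _; apply: mule_ge0; [exact: up0 | exact: (conv_ge0 kernel0M)].
- by move=> n x _; apply: mule_ge0; [exact: up0 | exact: (conv_ge0 (kM n))].
- move=> x Kx; have [e /= e0 eP] := kernel0_le_kappa_near hV W1 s01 rho0 hL Kx.
  have ee0 : 0 < e / eta by rewrite divr_gt0 ?bump_radius_gt0.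
  have [N _ NP] := near_infty_natSinv_lt (PosNum ee0).
  exists N => // n /= Nn; apply: lee_wpmul2l; first exact: up0.
  have h0 : 0 < h n by case/andP: (hh n).
  apply: eP => //=; rewrite sub0r normrN gtr0_norm//.
  by have := NP n Nn; rewrite /= ltr_pdivlMr ?bump_radius_gt0// mulrC.
- move=> n; apply: (@le_trans _ _ (kernel_energy V p u (kappa (h n)))).
    apply: (ge0_subset_integral mu mK measurableT); last exact: subsetT.
      exact: (mconv (mk n) (kM n)).
    by move=> x _; apply: mule_ge0; [exact: up0 | exact: (conv_ge0 (kM n))].
  apply: (kernel_energy_le cW mfu u0 (mk n) (kM n) _ eps0 C0 epsC a0).
    by rewrite mulr_ge0.
  by move=> z; exact: integral_kappa.
Qed.

Lemma lyapunov_split :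
  (b%:E * In <= (1 + eps)%:E *
     (M'%:E * Qn + (((1 + eps) * a)%:E * In + (C * (2 * Mk))%:E * En)) +
     (C * M')%:E * En)%E.
Proof.
have bb0 : 0 <= b by rewrite addr_ge0// mulr_ge0 ?divr_ge0// ltW.
apply: (le_trans (kernel_energy_ge cW mfu u0 mkernel0 kernel0M M'0 eps0 C0 epsC bb0 integral_kernel0)).
apply: leeD2r; apply: lee_wpmul2l; first by rewrite lee_fin addr_ge0// ltW.
have mK := cube_measurable (0 : L) (r + 2).
have k00 (x : L) : (0 <= (u x `^ p)%:E * \int[mu]_z (k0 (z - x) * W z)%:E)%E.
  by apply: mule_ge0; [exact: up0 | exact: (conv_ge0 kernel0M)].
have mU : measurable_fun (K `|` ~` K)
    (fun x : L => (u x `^ p)%:E * \int[mu]_z (k0 (z - x) * W z)%:E)%E.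
  by rewrite setUv; exact: (mconv mkernel0 kernel0M).
have dK : [disjoint K & ~` K]%classic by apply/disj_setPCl.
have KE := ge0_integral_setU mu mK (measurableC mK) mU (fun x _ => k00 x) dK.
rewrite setUv in KE; rewrite /kernel_energy KE.
by apply: leeD; [exact: kernel0_energy_inner | exact: kernel0_energy_outer].
Qed.

Lemma ball_energy_le :
  (kernel_energy V p u ball1 <= ((1 + eps) * m)%:E * In + C%:E * En)%E.
Proof.
have lM (v : L) : 0 <= ball1 v <= (1 : R) * ball1 v by rewrite mul1r lexx l0.
have := kernel_energy_le cW mfu u0 ml lM ler01 eps0 C0 epsC (ltW m0).
by rewrite mulr1; apply => z; rewrite ballE.
Qed.

Lemma ball_weightE (x : L) :
  (\int[mu]_(y in unit_ball x) (W y)%:E = \int[mu]_z (ball1 (z - x) * W z)%:E)%E.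
Proof.
rewrite integral_mkcond; apply: eq_integral => y _.
rewrite patchE ball1E; case: ifPn => [|/negP] h.
  by move/set_mem : h => h; rewrite ifT ?mul1r.
by rewrite ifF ?mul0r//; apply/negP => h'; apply: h; rewrite inE.
Qed.

Lemma weight_plusE (x : L) : ((weight_plus V x)%:E =
  (W x)%:E + m^-1%:E * \int[mu]_z (ball1 (z - x) * W z)%:E)%E.
Proof.
rewrite /weight_plus mE EFinD EFinM /Rintegral fineK ball_weightE//.
rewrite ge0_fin_numE; last first.
  by apply: integral_ge0 => z _; rewrite lee_fin mulr_ge0.
apply: (@le_lt_trans _ _ 1%E); last exact: ltry.
have mlW : measurable_fun setT (fun z : L => ball1 (z - x) * W z).
  exact: (measurable_funM (measurable_kernel2 x ml) mW).
rewrite -W1; apply: (le_integral_real mu mlW mW) => z.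
by rewrite mulr_ge0//= ler_piMl// ball1_le1.
Qed.

Lemma weight_plus_energyE : (\int[mu]_x (u x `^ p * weight_plus V x)%:E =
  In + m^-1%:E * kernel_energy V p u ball1)%E.
Proof.
have lM (v : L) : 0 <= ball1 v <= (1 : R) * ball1 v by rewrite mul1r lexx l0.
have mk := mconv ml lM.
have mi0 : (0 <= m^-1%:E)%E by rewrite lee_fin invr_ge0 ltW.
have k0' (x : L) : (0 <= (u x `^ p)%:E * \int[mu]_z (ball1 (z - x) * W z)%:E)%E.
  by apply: mule_ge0; [exact: up0 | exact: (conv_ge0 lM)].
rewrite /kernel_energy -(ge0_integralZl mu measurableT mk (fun x _ => k0' x) mi0).
have mupW : measurable_fun setT (fun x : L => (u x `^ p * W x)%:E).
  apply/measurable_EFinP.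
  exact: (measurable_funM (measurableT_comp (measurable_powR p) mfu) mW).
have upW0 (x : L) : setT x -> (0 <= (u x `^ p * W x)%:E)%E.
  by move=> _; rewrite lee_fin mulr_ge0 ?powR_ge0.
have mkZ := emeasurable_funM (measurable_cst m^-1%:E) mk.
have kZ0 (x : L) : setT x -> (0 <= m^-1%:E * ((u x `^ p)%:E * \int[mu]_z (ball1 (z - x) * W z)%:E))%E.
  by move=> _; exact: mule_ge0.
rewrite -(ge0_integralD mu measurableT upW0 mupW kZ0 mkZ).
by apply: eq_integral => x _; rewrite EFinM weight_plusE muleDr// muleCA.
Qed.

Variable N : R.
Hypothesis uN : forall x, u x <= N.
Hypothesis eps_small : (1 + eps) ^+ 2 * a < b.

(** Absorption in [lyapunov_split] bounds [In] by the fraction over D times [Qn + En]. Passing from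
    W to [weight_plus] turns this into (2 + eps) [In] + C / m [En]. *)
Definition lyapunov_const : R :=
  let D := b - (1 + eps) ^+ 2 * a in
  (2 + eps) * (((1 + eps) * M' + ((1 + eps) * (C * (2 * Mk)) + C * M')) / D) + C / m.

Lemma lyapunov_const_gt0 : 0 < lyapunov_const.
Proof.
apply: ltr_wpDl; last exact: divr_gt0.
have e1 : 0 <= 1 + eps by rewrite addr_ge0// ltW.
have e2 : 0 <= 2 + eps by rewrite addr_ge0// ltW.
have C1 := ltW C0.
by rewrite mulr_ge0// divr_ge0 ?subr_ge0 ?(ltW eps_small)// !addr_ge0// !mulr_ge0.
Qed.

Lemma lyapunov_bounded :
  (\int[mu]_x (u x `^ p * weight_plus V x)%:E <= lyapunov_const%:E * (Qn + En))%E.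
Proof.
have p0 : 0 <= p by rewrite (le_trans _ p1).
have upN x : u x `^ p <= N `^ p.
  by apply: ge0_ler_powR; rewrite ?nnegrE// (le_trans (u0 x)).
have Np0 : 0 <= N `^ p := powR_ge0 _ _.
have C1 := ltW C0; have e1 : 0 <= 1 + eps by rewrite addr_ge0// ltW.
have mupr : measurable_fun setT (fun x : L => u x `^ p).
  exact: (measurableT_comp (measurable_powR p) mfu).
have I0 : (0 <= In)%E by apply: integral_ge0 => x _; rewrite lee_fin mulr_ge0 ?powR_ge0.
have Q0 : (0 <= Qn)%E by apply: integral_ge0 => x _; exact: up0.
have E0 : (0 <= En)%E := energy_ge0 _ _ _.
(* Here the bound N on u is used: without finiteness [In] could not be subtracted from both
   sides. *)
have Ioo : (In < +oo)%E.
  apply: (@le_lt_trans _ _ (N `^ p)%:E); last exact: ltry.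
  rewrite -[leRHS]mule1 -W1 -(integralZl_real mu mW W0 Np0).
  apply: (le_integral_real mu (measurable_funM mupr mW) (measurable_funZl _ mW)) => x.
  by rewrite mulr_ge0 ?powR_ge0//= ler_wpM2r.
have Qoo : (Qn < +oo)%E.
  have mK := cube_measurable (0 : L) (r + 2).
  apply: (@le_lt_trans _ _ ((N `^ p)%:E * mu K)%E).
    rewrite -(integral_cst mu mK); apply: (ge0_le_integral _ mK).
    - by move=> x _; exact: up0.
    - exact: (measurable_funS measurableT (@subsetT _ _) mup).
    - exact: measurable_cst.
    - by move=> x _; rewrite lee_fin.
  apply: lte_mul_pinfty => //; exact: (cube_fin cW W1).
have S := lyapunov_split.
have T := ball_energy_le.
rewrite weight_plus_energyE.
move: S T E0 I0 Q0 Ioo Qoo.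
(* Infinite energy makes the right side +oo, since the constant is positive. *)
case: In => [i|//|//]; case: Qn => [q|//|//]; case: En => [e|_ _ _ _ _ _ _|//]; last first.
  by rewrite addey// gt0_muley ?leey// lte_fin lyapunov_const_gt0.
move=> S T; rewrite !lee_fin => E0 I0 Q0 _ _.
apply: (@le_trans _ _ (i%:E + m^-1%:E * (((1 + eps) * m)%:E * i%:E + C%:E * e%:E))%E).
  by apply: leeD2l; apply: lee_wpmul2l => //; rewrite lee_fin invr_ge0 ltW.
move: S; rewrite !(=^~ EFinM, =^~ EFinD, lee_fin) => S.
rewrite /lyapunov_const; set D := b - _; have D0 : 0 < D by rewrite subr_gt0.
set c1 := (1 + eps) * M'; set c2 := (1 + eps) * (C * (2 * Mk)) + C * M'.
have c10 : 0 <= c1 by rewrite mulr_ge0.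
have c20 : 0 <= c2 by rewrite !addr_ge0// !mulr_ge0.
have iD : i <= (c1 + c2) / D * (q + e).
  rewrite mulrAC ler_pdivlMr// /D /c1 /c2.
  have : 0 <= c1 * e by rewrite mulr_ge0.
  have : 0 <= c2 * q by rewrite mulr_ge0.
  rewrite /c1 /c2; lra.
have -> : i + m^-1 * ((1 + eps) * m * i + C * e) = (2 + eps) * i + C / m * e.
  by field; rewrite gt_eqF.
have e2 : 0 <= 2 + eps by rewrite addr_ge0// ltW.
have Cm : 0 <= C / m by rewrite divr_ge0// ltW.
rewrite [leRHS]mulrDl; apply: lerD.
  by rewrite -mulrA ler_wpM2l.
by rewrite ler_wpM2l// lerDr.
Qed.

End bounded_function.

End lyapunov2.

Lemma lyapunov_inequality (R : realType) (d : nat) (V : 'rV[R]_d -> R)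
    (s rho r p : R) : C2 V ->
  (\int[lebesgue_rV R d]_x (weight V x)%:E = 1)%E ->
  0 < s < 1 -> 0 < rho ->
  (forall x, r < enorm x -> rho <= s * enorm (grad V x) ^+ 2 - laplacian V x) ->
  1 <= p ->
  exists2 C : R, 0 < C & forall (u : 'rV[R]_d -> R) (N : R),
    measurable_fun setT u -> (forall x, 0 <= u x) -> (forall x, u x <= N) ->
    (\int[lebesgue_rV R d]_x (u x `^ p * weight_plus V x)%:E <=
     C%:E * (\int[lebesgue_rV R d]_(x in cube 0%R (r + 2)%R) (u x `^ p)%:E +
       energy V p u))%E.
Proof.
move=> hV W1 s01 rho0 hL p1; have cW := continuous_weight hV.
have [m m0 mE] := unit_ball_mass cW W1.
have [psi psi0 psiE] := bump_mass cW W1.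
pose a : R := @kappa_bound R d * m; pose D : R := rho / 2 * psi.
have a0 : 0 <= a by rewrite mulr_ge0 ?kappa_bound_ge0// ltW.
have D0 : 0 < D by rewrite mulr_gt0// divr_gt0.
(* Since eps <= 1, (1 + eps)^2 a <= a + 3 eps a, and 3 eps a = D a / (a + D + 1) < D. *)
pose eps : R := D / (3 * (a + D + 1)).
have den0 : 0 < 3 * (a + D + 1) by lra.
have eps0 : 0 < eps by rewrite divr_gt0.
have epsE : eps * (3 * (a + D + 1)) = D by rewrite /eps mulfVK// gt_eqF.
have eps1 : eps <= 1 by rewrite ler_pdivrMr// mul1r; lra.
have small : (1 + eps) ^+ 2 * a < a + D.
  have : 0 <= eps * D by rewrite mulr_ge0// ltW.
  have : eps * eps * a <= eps * a by rewrite ler_wpM2r// ler_piMl// ltW.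
  move: epsE; rewrite expr2; lra.
have [C C0 CP] := powR_le_split p1 eps0.
exists (@lyapunov_const R d rho m psi eps C).
  exact: (lyapunov_const_gt0 rho0 m0 eps0 C0 small).
move=> u N mfu u0 uN.
exact: (lyapunov_bounded hV W1 s01 rho0 hL p1 m0 psi0 mE psiE mfu u0 eps0 C0 CP uN small).
Qed.

(** * Chains of small cubes *)

Section local_poincare.
Context {R : realType} {d : nat}.
Notation B := (borel_rV R d).
Notation L := 'rV[R]_d.
Notation mu := (lebesgue_rV R d).
(** Smaller than the bump radius: here 3 eta is the threshold of [cube_enorm], spent as 2 eta for
    moving a centre and eta for the cube around it. *)
Local Notation eta := ((3 * d.+1%:R)^-1 : R).
Variable V : L -> R.
Hypothesis cW : continuous (weight V).
Notation W := (weight V).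
Hypothesis W1 : (\int[mu]_x (W x)%:E = 1)%E.
Variable p : R.
Hypothesis p1 : 1 <= p.
Let mW : measurable_fun setT W := measurable_weight cW.
Let W0 x : 0 <= W x := ltW (weight_gt0 V x).
Let Q (n : nat) : set L := cube 0 (n.+1%:R * eta).

Let mQ n : measurable (Q n) := cube_measurable _ _.

(** The base value f y is averaged over the cube [Q 0], since a bound at one prescribed point y
    cannot follow from integrals. *)
Definition chain (n : nat) (f : L -> R) : \bar R :=
  (\int[mu]_(y in Q 0) \int[mu]_(x in Q n) (`|f x - f y| `^ p)%:E)%E.

Lemma local_energy_le (n : nat) : exists2 C : R, 0 < C & forall f : L -> R,
  measurable_fun setT f ->
  (\int[mu]_(x in Q n) local_diff p f x <= C%:E * energy V p f)%E.
Proof.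
have [w w0 wW] := weight_cube_lb cW (0 : L) (n.+1%:R * eta).
exists w^-1; first by rewrite invr_gt0.
move=> f mf; have ml := measurable_local_diff p mf.
have l0 x : (0 <= local_diff p f x)%E := local_diff_ge0 _ _ _.
have mlW : measurable_fun setT (fun x : L => local_diff p f x * (W x)%:E)%E.
  by apply: (emeasurable_funM ml); apply/measurable_EFinP.
have lW0 x : (0 <= local_diff p f x * (W x)%:E)%E by rewrite mule_ge0 ?lee_fin.
have wi0 : (0 <= w^-1%:E)%E by rewrite lee_fin invr_ge0 ltW.
rewrite /energy -(ge0_integralZl mu measurableT mlW (fun x _ => lW0 x) wi0).
have mZ := emeasurable_funM (measurable_cst w^-1%:E) mlW.
have Z0 x : (0 <= w^-1%:E * (local_diff p f x * (W x)%:E))%E by exact: mule_ge0.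
apply: (le_trans _ (ge0_subset_integral mu (mQ n) measurableT mZ (fun x _ => Z0 x) (@subsetT _ _))).
apply: (ge0_le_integral _ (mQ n)).
- by move=> x _.
- exact: (measurable_funS measurableT (@subsetT _ _) ml).
- exact: (measurable_funS measurableT (@subsetT _ _) mZ).
- move=> x Qx; rewrite muleCA; rewrite -[leLHS]mule1; apply: lee_wpmul2l => //.
  by rewrite -EFinM lee_fin -ler_pdivrMl ?invr_gt0// invrK mulr1 wW.
Qed.

Lemma cube_sub_ball (x y : L) : (forall i, `|y ord0 i - x ord0 i| <= 3 * eta) -> unit_ball x y.
Proof.
move=> h; apply: cube_enorm => i; rewrite !mxE.
by rewrite (le_trans (h i))// invfM mulrA divff// mul1r.
Qed.

Let eta0 : 0 < eta. Proof. by rewrite invr_gt0 mulr_gt0. Qed.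

Let mfp (f : L -> R) (y : L) : measurable_fun setT f ->
  measurable_fun setT (fun x : L => (`|f x - f y| `^ p)%:E).
Proof.
by move=> mf; apply/measurable_EFinP; exact: (measurable_powR_dist p mf (measurable_cst (f y))).
Qed.

Lemma measurable_int_powR (f : L -> R) (A : set L) : measurable A -> measurable_fun setT f ->
  measurable_fun setT (fun y : L => \int[mu]_(x in A) (`|f x - f y| `^ p)%:E)%E.
Proof.
move=> mA mf.
have -> : (fun y : L => \int[mu]_(x in A) (`|f x - f y| `^ p)%:E)%E =
    fubini_F mu (fun q : L * L => (\1_A q.2 * `|f q.2 - f q.1| `^ p)%:E).
  apply/funext => y; rewrite [LHS]integral_mkcond; apply: eq_integral => x _.
  rewrite patchE /= indicE; case: ifPn => h; first by rewrite mul1r.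
  by rewrite mul0r.
apply: measurable_fun_fubini_tonelli_F => [|q]; last first.
  by rewrite lee_fin mulr_ge0 ?powR_ge0.
apply/measurable_EFinP; apply: measurable_funM.
  apply: (measurableT_comp _ measurable_snd); exact: measurable_indic.
apply: (measurableT_comp (measurable_powR p)); apply: measurableT_comp => //.
by apply: measurable_funB; [exact: (measurableT_comp mf measurable_snd)|
  exact: (measurableT_comp mf measurable_fst)].
Qed.

Lemma int_powR_ge0 (f : L -> R) (A : set L) y :
  (0 <= \int[mu]_(x in A) (`|f x - f y| `^ p)%:E)%E.
Proof. by apply: integral_ge0 => x _; rewrite lee_fin powR_ge0. Qed.

Lemma int_le_local_diff (f : L -> R) (A : set L) (x : L) : measurable_fun setT f ->
  measurable A -> A `<=` unit_ball x ->
  (\int[mu]_(t in A) (`|f t - f x| `^ p)%:E <= local_diff p f x)%E.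
Proof.
move=> mf mA Ax; rewrite /local_diff; under [leRHS]eq_integral do rewrite distrC.
apply: (ge0_subset_integral mu mA (unit_ball_measurable x) _ _ Ax).
- exact: (measurable_funS measurableT (@subsetT _ _) (mfp x mf)).
- by move=> t _; rewrite lee_fin powR_ge0.
Qed.

(** Two points of [Q 0] differ by less than 2 eta in each coordinate, so [Q 0] lies in the unit ball
    around each of its points. *)
Lemma chain0 : exists2 C : R, 0 < C & forall f : L -> R, measurable_fun setT f ->
  (chain 0 f <= C%:E * energy V p f)%E.
Proof.
have [C C0 CP] := local_energy_le 0; exists C; first exact: C0.
move=> f mf.
apply: (le_trans _ (CP f mf)); apply: (ge0_le_integral _ (mQ 0)).
- by move=> y _; exact: int_powR_ge0.
- exact: (measurable_funS measurableT (@subsetT _ _) (measurable_int_powR (mQ 0) mf)).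
- exact: (measurable_funS measurableT (@subsetT _ _) (measurable_local_diff p mf)).
- move=> y Qy; apply: (int_le_local_diff mf (mQ 0)) => x Qx; apply: cube_sub_ball => i.
  have := Qx i; have := Qy i; have := eta0.
  rewrite !mxE !subr0 !mul1r ler_norml !ltr_norml; move: (eta) => e e0.
  by move=> /andP[? ?] /andP[? ?]; apply/andP; split; lra.
Qed.

(* Scaling by n / (n + 2) moves x by at most 2 eta in each coordinate and makes
   room for a cube of radius eta inside Q n. *)
Lemma cube_chain (n : nat) (x : L) : Q n.+1 x ->
  exists2 t : L, cube t eta `<=` Q n & cube t eta `<=` unit_ball x.
Proof.
move=> Qx; pose c : R := n%:R / n.+2%:R.
have n2 : 0 < n.+2%:R :> R by [].
have cE : c * n.+2%:R = n%:R by rewrite /c mulfVK// gt_eqF.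
have c01 : 0 <= c by rewrite divr_ge0.
exists (c *: x) => y cy.
  move=> i; have := cy i; have := Qx i; rewrite !mxE !subr0 => xi yi.
  have -> : y ord0 i = c * x ord0 i + (y ord0 i - c * x ord0 i) by ring.
  rewrite (le_lt_trans (ler_normD _ _))// -natr1 mulrDl mul1r ler_ltD//.
  rewrite normrM ger0_norm//.
  apply: (@le_trans _ _ (c * (n.+2%:R * eta))); first by rewrite ler_wpM2l// ltW.
  by rewrite mulrA cE.
apply: cube_sub_ball => i; have := cy i; have := Qx i; rewrite !mxE !subr0 => xi yi.
have -> : y ord0 i - x ord0 i = (y ord0 i - c * x ord0 i) - (1 - c) * x ord0 i by ring.
rewrite (le_trans (ler_normB _ _))//.
have c1 : 0 <= 1 - c.
  by rewrite subr_ge0 /c ler_pdivrMr// mul1r ler_nat -addn2 leq_addr.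
have E : (1 - c) * n.+2%:R = 2 by rewrite mulrBl cE mul1r -addn2 natrD; ring.
rewrite (_ : 3 * eta = eta + 2 * eta); last by ring.
rewrite lerD ?(ltW yi)// normrM ger0_norm// -E -mulrA.
by rewrite ler_wpM2l// ltW.
Qed.

(** For x in [Q n.+1], a cube inside [Q n] and the unit ball of x provides intermediate points z.
    Averaging |f x - f y|^p <= 2 |f z - f x|^p + K |f z - f y|^p over z leaves a local difference at
    x and the integral for [Q n]. *)
Lemma chain_step (n : nat) (C : R) : 0 < C ->
  (forall f : L -> R, measurable_fun setT f -> (chain n f <= C%:E * energy V p f)%E) ->
  exists2 C' : R, 0 < C' & forall f : L -> R, measurable_fun setT f ->
  (chain n.+1 f <= C'%:E * energy V p f)%E.
Proof.
move=> C0 CP; have [D D0 DP] := local_energy_le n.+1.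
have [K K0 KP] := powR_le_split p1 (ltr01 : 0 < (1 : R)).
have fincube (t : L) e : mu (cube t e) = (fine (mu (cube t e)))%:E.
  by rewrite fineK// ge0_fin_numE ?measure_ge0//; exact: (cube_fin cW W1).
have [q [q0 qE]] : exists q : R, 0 < q /\ forall t : L, mu (cube t eta) = q%:E.
  exists (fine (mu (cube (0 : L) eta))); split.
    by rewrite -lte_fin -fincube; exact: (cube_gt0 cW W1).
  by move=> t; rewrite -fincube; exact: cube_shift.
pose q1 := fine (mu (Q 0)); pose q2 := fine (mu (Q n.+1)).
have q1E : mu (Q 0) = q1%:E := fincube _ _.
have q2E : mu (Q n.+1) = q2%:E := fincube _ _.
have q1p : 0 <= q1 by apply: fine_ge0; exact: measure_ge0.
have q2p : 0 <= q2 by apply: fine_ge0; exact: measure_ge0.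
(* The summand 1 gives positivity when only q1, q2 >= 0 is recorded; positivity settles the case of
   infinite energy. *)
exists (q^-1 * (2 * q1 * D + K * q2 * C) + 1).
  by rewrite ltr_wpDl// mulr_ge0 ?invr_ge0 ?(ltW q0)// addr_ge0// !mulr_ge0// ltW.
move=> f mf; have E0 : (0 <= energy V p f)%E := energy_ge0 _ _ _.
have ml := measurable_local_diff p mf.
have l0 x : (0 <= local_diff p f x)%E := local_diff_ge0 _ _ _.
pose g (y : L) : \bar R := (\int[mu]_(t in Q n) (`|f t - f y| `^ p)%:E)%E.
have g0 y : (0 <= g y)%E := int_powR_ge0 _ _ _.
have mg : measurable_fun setT g := measurable_int_powR (mQ n) mf.
(* The small cube depends on x, but its measure q does not, and enlarging it to the ball or to [Q n]
   removes it from the right side. *)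
have pt x y : Q n.+1 x -> ((q * `|f x - f y| `^ p)%:E <= 2%:E * local_diff p f x + K%:E * g y)%E.
  move=> Qx; have [t tQ tB] := cube_chain Qx.
  have mt := cube_measurable t eta.
  have m1 : measurable_fun (cube t eta) (fun z : L => (`|f z - f x| `^ p)%:E).
    exact: (measurable_funS measurableT (@subsetT _ _) (mfp x mf)).
  have m2 : measurable_fun (cube t eta) (fun z : L => (`|f z - f y| `^ p)%:E).
    exact: (measurable_funS measurableT (@subsetT _ _) (mfp y mf)).
  have z1 x' (z : L) : cube t eta z -> (0 <= (`|f z - f x'| `^ p)%:E)%E.
    by move=> _; rewrite lee_fin powR_ge0.
  have K0e : (0 <= K%:E)%E by rewrite lee_fin ltW.
  apply: (@le_trans _ _ (2%:E * \int[mu]_(z in cube t eta) (`|f z - f x| `^ p)%:E +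
      K%:E * \int[mu]_(z in cube t eta) (`|f z - f y| `^ p)%:E)%E); last first.
    apply: leeD; apply: lee_wpmul2l; [by rewrite lee_fin | exact: int_le_local_diff | exact: K0e |].
    apply: (ge0_subset_integral mu mt (mQ n) _ _ tQ).
      exact: (measurable_funS measurableT (@subsetT _ _) (mfp y mf)).
    by move=> z _; rewrite lee_fin powR_ge0.
  have n2 : (0 <= 2%:E :> \bar R)%E by rewrite lee_fin.
  have mm1 := emeasurable_funM (measurable_cst (2%:E : \bar R)) m1.
  have mm2 := emeasurable_funM (measurable_cst K%:E) m2.
  rewrite -(ge0_integralZl mu mt m1 (z1 x) n2) -(ge0_integralZl mu mt m2 (z1 y) K0e).
  rewrite -(ge0_integralD mu mt (fun z h => mule_ge0 n2 (z1 x z h)) mm1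
    (fun z h => mule_ge0 K0e (z1 y z h)) mm2).
  rewrite mulrC EFinM -(qE t) -(integral_cst mu mt); apply: (ge0_le_integral _ mt).
  - by move=> z _; rewrite lee_fin powR_ge0.
  - exact: measurable_cst.
  - exact: (emeasurable_funD mm1 mm2).
  - move=> z _; rewrite -!EFinM -EFinD lee_fin; apply: KP => //.
    by rewrite [`|f z - f x|]distrC; exact: ler_distD.
have mlQ : measurable_fun (Q n.+1) (local_diff p f).
  exact: (measurable_funS measurableT (@subsetT _ _) ml).
have n2 : (0 <= 2%:E :> \bar R)%E by rewrite lee_fin.
have K0e : (0 <= K%:E)%E by rewrite lee_fin ltW.
have q0e : (0 <= q%:E)%E by rewrite lee_fin ltW.
have inner y : (q%:E * \int[mu]_(x in Q n.+1) (`|f x - f y| `^ p)%:E <=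
    2%:E * (D%:E * energy V p f) + (K * q2)%:E * g y)%E.
  have mf1 : measurable_fun (Q n.+1) (fun x : L => (`|f x - f y| `^ p)%:E).
    exact: (measurable_funS measurableT (@subsetT _ _) (mfp y mf)).
  have mm1 := emeasurable_funM (measurable_cst (2%:E : \bar R)) mlQ.
  rewrite -(ge0_integralZl mu (mQ n.+1) mf1 _ q0e); last first.
    by move=> x _; rewrite lee_fin powR_ge0.
  have Kg0 : (0 <= K%:E * g y)%E := mule_ge0 K0e (g0 y).
  apply: (@le_trans _ _ (\int[mu]_(x in Q n.+1) (2%:E * local_diff p f x + cst (K%:E * g y) x))%E).
    apply: (ge0_le_integral _ (mQ n.+1)).
    - by move=> x _; rewrite mule_ge0// lee_fin powR_ge0.
    - exact: (emeasurable_funM (measurable_cst q%:E) mf1).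
    - exact: (emeasurable_funD mm1 (measurable_cst _)).
    - by move=> x Qx; rewrite -EFinM; exact: pt.
  rewrite (ge0_integralD mu (mQ n.+1) (fun x _ => mule_ge0 n2 (l0 x)) mm1 (fun x _ => Kg0) (measurable_cst _)).
  rewrite (ge0_integralZl mu (mQ n.+1) mlQ (fun x _ => l0 x) n2) (integral_cst mu (mQ n.+1)).
  apply: leeD; first by apply: lee_wpmul2l; [exact: n2 | exact: DP].
  have -> : (K * q2)%:E = (K%:E * mu (Q n.+1))%E by rewrite q2E -EFinM.
  by rewrite muleAC; exact: lexx.
have mg0 : measurable_fun (Q 0) g by exact: (measurable_funS measurableT (@subsetT _ _) mg).
have mF : measurable_fun (Q 0) (fun y : L => \int[mu]_(x in Q n.+1) (`|f x - f y| `^ p)%:E)%E.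
  exact: (measurable_funS measurableT (@subsetT _ _) (measurable_int_powR (mQ n.+1) mf)).
have DE0 : (0 <= 2%:E * (D%:E * energy V p f))%E by rewrite !mule_ge0// lee_fin ltW.
have Kq0 : (0 <= (K * q2)%:E)%E by rewrite lee_fin mulr_ge0// ltW.
have mm2 := emeasurable_funM (measurable_cst (K * q2)%:E) mg0.
have : (q%:E * chain n.+1 f <= q1%:E * (2%:E * (D%:E * energy V p f)) + (K * q2)%:E * (C%:E * energy V p f))%E.
  rewrite /chain -(ge0_integralZl mu (mQ 0) mF (fun y _ => int_powR_ge0 _ _ _) q0e).
  apply: (@le_trans _ _ (\int[mu]_(y in Q 0) (cst (2%:E * (D%:E * energy V p f)) y + (K * q2)%:E * g y))%E).
    apply: (ge0_le_integral _ (mQ 0)).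
    - by move=> y _; apply: mule_ge0 => //; exact: int_powR_ge0.
    - exact: (emeasurable_funM (measurable_cst q%:E) mF).
    - exact: (emeasurable_funD (measurable_cst _) mm2).
    - by move=> y _; exact: inner.
  rewrite (ge0_integralD mu (mQ 0) (fun y _ => DE0) (measurable_cst _) (fun y _ => mule_ge0 Kq0 (g0 y)) mm2).
  rewrite (integral_cst mu (mQ 0)) (ge0_integralZl mu (mQ 0) mg0 (fun y _ => g0 y) Kq0).
  apply: leeD; first by rewrite muleC -q1E; exact: lexx.
  by apply: lee_wpmul2l; [exact: Kq0 | exact: CP].
have ch0 : (0 <= chain n.+1 f)%E by apply: integral_ge0 => y _; exact: int_powR_ge0.
move: E0 ch0; case: (energy V p f) => [e|_ _ _|//]; last first.
  by rewrite gt0_muley ?leey// lte_fin ltr_wpDl// mulr_ge0 ?invr_ge0 ?(ltW q0)// addr_ge0// !mulr_ge0// ltW.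
move=> e0; rewrite lee_fin in e0; rewrite -!EFinM -EFinD.
case: (chain n.+1 f) => [c|_|//]; last by rewrite gt0_muley ?lte_fin// leye_eq.
move=> _; rewrite -EFinM !lee_fin => H.
set X := 2 * q1 * D + _.
have -> : (q^-1 * X + 1) * e = q^-1 * (X * e) + e by ring.
apply: (@le_trans _ _ (q^-1 * (X * e))); last by rewrite lerDl.
by rewrite ler_pdivlMl// (le_trans H)// /X le_eqVlt; apply/orP; left; apply/eqP; ring.
Qed.

Lemma chain_le (n : nat) : exists2 C : R, 0 < C & forall f : L -> R,
  measurable_fun setT f -> (chain n f <= C%:E * energy V p f)%E.
Proof.
elim: n => [|n [C C0 CP]]; first exact: chain0.
exact: (chain_step C0 CP).
Qed.

End local_poincare.

(** * Truncation and the mean-zero condition *)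

Section mean_zero.
Context {R : realType} {d : nat}.
Notation B := (borel_rV R d).
Notation L := 'rV[R]_d.
Notation mu := (lebesgue_rV R d).
Variable V : L -> R.
Hypothesis hV : C2 V.
Notation W := (weight V).
Let cW : continuous W := continuous_weight hV.
Hypothesis W1 : (\int[mu]_x (W x)%:E = 1)%E.
Variable p : R.
Hypothesis p1 : 1 <= p.
Let mW : measurable_fun setT W := measurable_weight cW.
Let W0 x : 0 <= W x := ltW (weight_gt0 V x).

Lemma weight_plus_ge x : W x <= weight_plus V x.
Proof.
rewrite lerDl; apply: mulr_ge0.
  by rewrite invr_ge0; apply: fine_ge0; exact: measure_ge0.
by rewrite /Rintegral; apply: fine_ge0; apply: integral_ge0 => y _; rewrite lee_fin.
Qed.

Lemma measurable_weight_plus : measurable_fun setT (weight_plus V).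
Proof.
have [m m0 mE] := unit_ball_mass cW W1.
apply/measurable_EFinP.
apply: (eq_measurable_fun (fun x : L =>
   (W x)%:E + m^-1%:E * \int[mu]_z (ball1 (z - x) * W z)%:E)%E).
  by move=> x _; rewrite /= (weight_plusE hV W1 mE).
have lM (v : L) : 0 <= ball1 v <= (1 : R) * ball1 v by rewrite mul1r lexx ball1_ge0.
have mWE : measurable_fun setT (fun x : L => (W x)%:E) by apply/measurable_EFinP.
apply: (emeasurable_funD mWE); apply: (emeasurable_funM (measurable_cst _)).
exact: (measurable_kernel_weight cW (@measurable_borel_ball1 R d) lM).
Qed.

Let Wp0 x : 0 <= weight_plus V x := le_trans (W0 x) (weight_plus_ge x).

Variable f : L -> R.
Hypothesis mf : measurable_fun setT f.

Let mfc (c : R) : measurable_fun setT (fun x : L => `|f x - c|).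
Proof.
exact: (measurableT_comp (@normr_measurable R setT) (measurable_funB mf (measurable_cst c))).
Qed.

Let mfcp (c : R) : measurable_fun setT (fun x : L => `|f x - c| `^ p).
Proof. exact: (measurableT_comp (measurable_powR p) (mfc c)). Qed.

Lemma energy_contract (u : L -> R) : measurable_fun setT u ->
  (forall x y, `|u x - u y| <= `|f x - f y|) -> (energy V p u <= energy V p f)%E.
Proof.
move=> mfu uf; have p0 : 0 <= p by rewrite (le_trans _ p1).
have mWE : measurable_fun setT (fun x : L => (W x)%:E) by apply/measurable_EFinP.
apply: (ge0_le_integral _ measurableT).
- by move=> x _; apply: mule_ge0; [exact: local_diff_ge0 | rewrite lee_fin].
- exact: (emeasurable_funM (measurable_local_diff p mfu) mWE).
- exact: (emeasurable_funM (measurable_local_diff p mf) mWE).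
move=> x _; apply: lee_wpmul2r; first by rewrite lee_fin.
rewrite !local_diffE.
have ml := measurable_kernel1 x (@measurable_borel_ball1 R d).
apply: (le_integral_real mu
   (measurable_funM ml (measurable_powR_dist p (measurable_cst (u x)) mfu))
   (measurable_funM ml (measurable_powR_dist p (measurable_cst (f x)) mf))) => y.
rewrite mulr_ge0 ?ball1_ge0 ?powR_ge0//= ler_wpM2l ?ball1_ge0//.
by apply: ge0_ler_powR; rewrite ?nnegrE.
Qed.

(** The truncation min(|f - c|, n) equals |f - c| for all large n at each point, and it never
    increases differences of f, so its energy is at most that of f. *)
Lemma truncation_limit (K : set L) (C : R) (c : R) : 0 < C -> measurable K ->
  (forall (u : L -> R) (N : R), measurable_fun setT u -> (forall x, 0 <= u x) ->
    (forall x, u x <= N) ->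
    (\int[mu]_x (u x `^ p * weight_plus V x)%:E <=
     C%:E * (\int[mu]_(x in K) (u x `^ p)%:E + energy V p u))%E) ->
  (\int[mu]_x (`|f x - c| `^ p * weight_plus V x)%:E <=
     C%:E * (\int[mu]_(x in K) (`|f x - c| `^ p)%:E + energy V p f))%E.
Proof.
move=> C0 mK CP; have p0 : 0 <= p by rewrite (le_trans _ p1).
pose u (n : nat) (x : L) : R := Num.min `|f x - c| n%:R.
have u0 n x : 0 <= u n x by rewrite /u le_min normr_ge0/=.
have mun n : measurable_fun setT (u n).
  by apply: measurable_minr; [exact: mfc | exact: measurable_cst].
have mup n : measurable_fun setT (fun x : L => u n x `^ p).
  exact: (measurableT_comp (measurable_powR p) (mun n)).
apply: (@integral_le_eventually _ _ _ mu setT _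
  (fun n x => (u n x `^ p * weight_plus V x)%:E) _ measurableT).
- by apply/measurable_EFinP; exact: (measurable_funM (mfcp c) measurable_weight_plus).
- by move=> n; apply/measurable_EFinP; exact: (measurable_funM (mup n) measurable_weight_plus).
- by move=> x _; rewrite lee_fin mulr_ge0 ?powR_ge0.
- by move=> n x _; rewrite lee_fin mulr_ge0 ?powR_ge0.
- move=> x _; exists (Num.truncn `|f x - c|).+1 => // n /= hn.
  rewrite lee_fin ler_wpM2r// /u min_l//.
  by rewrite (le_trans (ltW (truncnS_gt _)))// ler_nat.
move=> n; apply: (le_trans (CP (u n) n%:R (mun n) (u0 n) _)).
  by move=> x; rewrite /u ge_min lexx orbT.
apply: lee_wpmul2l; first by rewrite lee_fin ltW.
apply: leeD.
  apply: (ge0_le_integral _ mK).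
  - by move=> x _; rewrite lee_fin powR_ge0.
  - by apply: (measurable_funS measurableT (@subsetT _ _)); apply/measurable_EFinP; exact: mup.
  - by apply: (measurable_funS measurableT (@subsetT _ _)); apply/measurable_EFinP; exact: mfcp.
  - move=> x _; rewrite lee_fin; apply: ge0_ler_powR; rewrite ?nnegrE//.
    by rewrite /u ge_min lexx.
apply: energy_contract => // x y.
have h : `| `|f x - c| - `|f y - c| | <= `|f x - f y|.
  apply: (le_trans (ler_dist_dist _ _)).
  by rewrite (_ : f x - c - (f y - c) = f x - f y)//; ring.
move: h; rewrite /u; move: `|f x - c| `|f y - c| `|f x - f y| (n%:R : R) => a b e k.
rewrite !ler_norml => /andP[h1 h2].
by case: (leP a k) => ak; case: (leP b k) => bk; apply/andP; split; lra.
Qed.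

Hypothesis fW : mu.-integrable setT (fun x => (f x * W x)%:E).
Hypothesis fW0 : (\int[mu]_x (f x * W x)%:E = 0)%E.

(** Because W has mass 1 and fW has integral 0, the integral of (f - c) W is -c. *)
Lemma mean_le (c : R) :
  (`|c|%:E <= \int[mu]_x (`|f x - c| * W x)%:E)%E.
Proof.
have iW : mu.-integrable setT (fun x : L => (W x)%:E).
  apply/integrableP; split; first by apply/measurable_EFinP.
  under eq_integral do rewrite gee0_abs ?lee_fin//.
  by rewrite W1 ltry.
have icW : mu.-integrable setT (fun x : L => c%:E * (W x)%:E)%E by exact: integrableZl.
have E : (\int[mu]_x ((f x * W x)%:E - c%:E * (W x)%:E) = - c%:E)%E.
  by rewrite integralB// fW0 integralZl// W1 mule1 sub0e.
have -> : `|c|%:E = `|\int[mu]_x ((f x * W x)%:E - c%:E * (W x)%:E)|%E.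
  by rewrite E -EFinN /= normrN.
have iB := integrableB measurableT fW icW.
apply: (le_trans (le_abse_integral mu measurableT (measurable_int _ iB))).
rewrite le_eqVlt; apply/orP; left; apply/eqP; apply: eq_integral => x _.
by rewrite -EFinM -EFinB /= -mulrBl normrM (ger0_norm (W0 x)).
Qed.

(** In place of Jensen's inequality: with l = |c| / 2, every a >= 0 satisfies l^(p-1) a <= l^p +
    a^p. Integrating at a = |f - c| and using [mean_le] gives 2 l^p <= l^p + J, with J the integral
    on the right, and |c|^p = 2^p l^p. *)
Lemma mean_powR_le (c : R) :
  ((`|c| `^ p)%:E <= (2 `^ p)%:E * \int[mu]_x (`|f x - c| `^ p * W x)%:E)%E.
Proof.
have p0 : 0 < p by rewrite (lt_le_trans _ p1).
have J0 : (0 <= \int[mu]_x (`|f x - c| `^ p * W x)%:E)%E.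
  by apply: integral_ge0 => x _; rewrite lee_fin mulr_ge0 ?powR_ge0.
have [->|c0] := eqVneq c 0.
  rewrite normr0 powR0 ?gt_eqF//; apply: mule_ge0; first by rewrite lee_fin powR_ge0.
  by apply: integral_ge0 => x _; rewrite lee_fin mulr_ge0 ?powR_ge0.
pose l : R := `|c| / 2; have l0 : 0 < l by rewrite divr_gt0 ?normr_gt0.
have cl : `|c| = 2 * l by rewrite /l mulrC divfK.
have lp : l `^ (p - 1) * l = l `^ p.
  by rewrite -{2}(powRr1 (ltW l0)) -powRD ?subrK// gt_eqF ?implybT.
have q0 : 0 <= p - 1 by rewrite subr_ge0.
have pt a : 0 <= a -> l `^ (p - 1) * a <= l `^ p + a `^ p.
  move=> a0; case: (leP a l) => al.
    by rewrite -lp (le_trans (ler_wpM2l (powR_ge0 _ _) al))// lerDl powR_ge0.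
  have a1 : 0 < a := lt_trans l0 al.
  apply: (@le_trans _ _ (a `^ p)); last by rewrite lerDr powR_ge0.
  have -> : a `^ p = a `^ (p - 1) * a.
    by rewrite -{3}(powRr1 a0) -powRD ?subrK// (gt_eqF a1) implybT.
  apply: ler_wpM2r => //; apply: ge0_ler_powR; rewrite ?nnegrE// ltW//.
have mpW : measurable_fun setT (fun x : L => `|f x - c| `^ p * W x).
  exact: (measurable_funM (mfcp c) mW).
have m1W : measurable_fun setT (fun x : L => `|f x - c| * W x).
  exact: (measurable_funM (mfc c) mW).
have lp0 := powR_ge0 l p; have lq0 := powR_ge0 l (p - 1).
have H : ((l `^ (p - 1))%:E * `|c|%:E <=
    (l `^ p)%:E + \int[mu]_x (`|f x - c| `^ p * W x)%:E)%E.
  apply: (le_trans (lee_wpmul2l _ (mean_le c))); first by rewrite lee_fin.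
  rewrite -(integralZl_real mu m1W (fun x => mulr_ge0 (normr_ge0 _) (W0 x)) lq0).
  rewrite -[X in (_ <= X + _)%E]mule1 -W1 -(integralZl_real mu mW W0 lp0).
  rewrite -(integralD_real mu (measurable_funZl _ mW) mpW); first last.
  - by move=> x; rewrite mulr_ge0 ?powR_ge0.
  - by move=> x; rewrite mulr_ge0.
  apply: (le_integral_real mu (measurable_funZl _ m1W) (measurable_funD (measurable_funZl _ mW) mpW)) => x.
  rewrite !mulr_ge0//= mulrA -mulrDl ler_wpM2r//; exact: pt.
move: H J0; case: (\int[mu]_x _)%E => [j|_ _|//]; last first.
  by rewrite gt0_muley ?leey// lte_fin powR_gt0.
rewrite -!EFinM -EFinD !lee_fin cl => H j0.
rewrite powRM ?(ltW l0)// ler_wpM2l ?powR_ge0//.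
by move: H; rewrite mulrCA lp; lra.
Qed.

(** Splitting f = (f - c) + c leaves |c|^p times the mass [om] of [weight_plus], and [mean_powR_le]
    controls |c|^p. The factor 1 + 1 is [powR_le_split] at eps = 1. *)
Lemma center_bound (K om : R) (K0 : 0 < K) (c : R) :
  (forall a b e, 0 <= a -> 0 <= b -> 0 <= e -> e <= a + b ->
    e `^ p <= (1 + 1) * a `^ p + K * b `^ p) ->
  (\int[mu]_x (weight_plus V x)%:E = om%:E)%E ->
  (\int[mu]_x (`|f x| `^ p * weight_plus V x)%:E <=
   (2 + K * om * 2 `^ p)%:E * \int[mu]_x (`|f x - c| `^ p * weight_plus V x)%:E)%E.
Proof.
move=> KP omE; have mWp := measurable_weight_plus.
have om0 : 0 <= om by rewrite -lee_fin -omE; apply: integral_ge0 => x _; rewrite lee_fin.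
have mcW := measurable_funM (mfcp c) mWp.
have cW0 x : 0 <= `|f x - c| `^ p * weight_plus V x by rewrite mulr_ge0 ?powR_ge0.
have mfW : measurable_fun setT (fun x : L => `|f x| `^ p * weight_plus V x).
  apply: (measurable_funM _ mWp); apply: (measurableT_comp (measurable_powR p)).
  exact: (measurableT_comp (@normr_measurable R setT) mf).
have Kc0 : 0 <= K * `|c| `^ p by rewrite mulr_ge0 ?powR_ge0// ltW.
apply: (@le_trans _ _ (\int[mu]_x (2 * (`|f x - c| `^ p * weight_plus V x) +
    K * `|c| `^ p * weight_plus V x)%:E)%E).
  apply: (le_integral_real mu mfW (measurable_funD (measurable_funZl 2 mcW) (measurable_funZl _ mWp))) => x.
  rewrite mulr_ge0 ?powR_ge0//= mulrA -mulrDl ler_wpM2r//.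
  have := KP _ _ _ (normr_ge0 (f x - c)) (normr_ge0 c) (normr_ge0 (f x)).
  rewrite (_ : 1 + 1 = 2 :> R)//; apply.
  by rewrite -{1}(subrK c (f x)) ler_normD.
have n2 : 0 <= 2 :> R by [].
rewrite (integralD_real mu (measurable_funZl 2 mcW) (measurable_funZl _ mWp)); first last.
- by move=> x; exact: (mulr_ge0 Kc0 (Wp0 x)).
- by move=> x; exact: (mulr_ge0 n2 (cW0 x)).
rewrite (integralZl_real mu mcW cW0 n2) (integralZl_real mu mWp Wp0 Kc0) omE.
have JW : (\int[mu]_x (`|f x - c| `^ p * W x)%:E <=
    \int[mu]_x (`|f x - c| `^ p * weight_plus V x)%:E)%E.
  apply: (le_integral_real mu (measurable_funM (mfcp c) mW) mcW) => x.
  by rewrite mulr_ge0 ?powR_ge0//= ler_wpM2l ?powR_ge0// weight_plus_ge.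
have := le_trans (mean_powR_le c) (lee_wpmul2l _ JW).
rewrite lee_fin powR_ge0 => /(_ isT).
have : (0 <= \int[mu]_x (`|f x - c| `^ p * weight_plus V x)%:E)%E.
  by apply: integral_ge0 => x _; rewrite lee_fin.
have A0 : 0 < 2 + K * om * 2 `^ p.
  by rewrite ltr_wpDr// !mulr_ge0 ?powR_ge0// ltW.
case: (\int[mu]_x _)%E => [j|_ _|//]; last by rewrite [leRHS]gt0_muley ?leey// lte_fin.
rewrite -!EFinM -EFinD !lee_fin => j0 cj.
rewrite [leRHS]mulrDl lerD2l.
have -> : K * om * 2 `^ p * j = K * (2 `^ p * j) * om by ring.
by rewrite ler_wpM2r// ler_wpM2l// ltW.
Qed.

End mean_zero.

(** Take p = 1 and u = 1 in the Lyapunov inequality: the energy vanishes and the measure of a cube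
    remains. *)
Lemma weight_plus_mass (R : realType) (d : nat) (V : 'rV[R]_d -> R)
    (s rho r : R) : C2 V ->
  (\int[lebesgue_rV R d]_x (weight V x)%:E = 1)%E ->
  0 < s < 1 -> 0 < rho ->
  (forall x, r < enorm x -> rho <= s * enorm (grad V x) ^+ 2 - laplacian V x) ->
  exists om : R, (\int[lebesgue_rV R d]_x (weight_plus V x)%:E = om%:E)%E.
Proof.
move=> hV W1 s01 rho0 hL; have cW := continuous_weight hV.
have [C C0 CP] := lyapunov_inequality hV W1 s01 rho0 hL (lexx 1).
have Wp0 x : 0 <= weight_plus V x := le_trans (ltW (weight_gt0 V x)) (weight_plus_ge V x).
have := CP (cst 1) 1 (measurable_cst _) (fun=> ler01) (fun=> lexx 1).
set I := (\int[_]_x _)%E => H.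
have IE : I = (\int[lebesgue_rV R d]_x (weight_plus V x)%:E)%E.
  by apply: eq_integral => x _; rewrite powR1 mul1r.
have E0 : energy V 1 (cst 1) = 0%E.
  rewrite /energy (eq_integral (cst 0%E)) ?integral0// => x _.
  rewrite /local_diff (eq_integral (cst 0%E)) ?integral0 ?mul0e// => y _.
  by rewrite subrr normr0 powR0// oner_neq0.
have mK := cube_measurable (0 : 'rV[R]_d) (r + 2).
have Q : (\int[lebesgue_rV R d]_(x in cube 0%R (r + 2)%R) ((cst 1 x : R) `^ 1)%:E =
    lebesgue_rV R d (cube 0%R (r + 2)%R))%E.
  rewrite (eq_integral (cst 1%E)); last by move=> x _; rewrite powR1.
  by rewrite (integral_cst _ mK) mul1e.
have Ioo : (I < +oo)%E.
  apply: (le_lt_trans H); rewrite E0 adde0 Q.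
  by apply: lte_mul_pinfty; [rewrite lee_fin ltW | | exact: (cube_fin cW W1)].
exists (fine I); rewrite fineK -?IE// ge0_fin_numE// IE.
by apply: integral_ge0 => x _; rewrite lee_fin.
Qed.

(** * Averaging over the centre c = f y *)

Theorem corollary1 (R : realType) (d : nat) (V : 'rV[R]_d -> R) (s rho r : R) :
  C2 V ->
  (\int[lebesgue_rV R d]_x (weight V x)%:E = 1)%E ->
  0 < s < 1 ->
  0 < rho ->
  (forall x, r < enorm x -> rho <= s * enorm (grad V x) ^+ 2 - laplacian V x) ->
  forall p : R, 1 <= p ->
  exists C : R, forall f : 'rV[R]_d -> R,
    measurable_fun [set: 'rV[R]_d] f ->
    (lebesgue_rV R d).-integrable [set: 'rV[R]_d] (fun x => (f x * weight V x)%:E) ->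
    (\int[lebesgue_rV R d]_x (f x * weight V x)%:E = 0)%E ->
    (\int[lebesgue_rV R d]_x (`|f x| `^ p * weight_plus V x)%:E <=
     C%:E * \int[lebesgue_rV R d]_x
       ((\int[lebesgue_rV R d]_(y in unit_ball x) (`|f x - f y| `^ p)%:E) *
        (weight V x)%:E))%E.
Proof.
move=> hV W1 s01 rho0 hL p p1; have cW := continuous_weight hV.
pose mu := lebesgue_rV R d.
have [C C0 CP] := lyapunov_inequality hV W1 s01 rho0 hL p1.
have [om omE] := weight_plus_mass hV W1 s01 rho0 hL.
have [K K0 KP] := powR_le_split p1 (ltr01 : 0 < (1 : R)).
pose eta : R := (3 * d.+1%:R)^-1.
have eta0 : 0 < eta by rewrite invr_gt0 mulr_gt0.
(* Then (n + 1) eta > r + 2, so the chain of cubes reaches beyond the exceptional cube. *)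
pose n := Num.truncn ((r + 2) / eta).
pose Q (k : nat) : set 'rV[R]_d := cube 0 (k.+1%:R * eta).
have mQ k : measurable (Q k) := cube_measurable _ _.
have subQ : cube 0 (r + 2) `<=` Q n.
  move=> x xr i; apply: (lt_le_trans (xr i)).
  by rewrite -ler_pdivrMr// ltW// truncnS_gt.
have [D D0 DP] := chain_le cW W1 p1 n.
have q0 : (0 < mu (Q 0%N))%E by apply: (cube_gt0 cW W1); rewrite mul1r.
have qoo : (mu (Q 0%N) < +oo)%E := cube_fin cW W1 _ _.
pose q := fine (mu (Q 0%N)).
have qE : mu (Q 0%N) = q%:E by rewrite fineK// ge0_fin_numE// ltW.
have {}q0 : 0 < q by rewrite -lte_fin -qE.
have om0 : 0 <= om.
  rewrite -lee_fin -omE; apply: integral_ge0 => x _; rewrite lee_fin.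
  exact: le_trans (ltW (weight_gt0 V x)) (weight_plus_ge V x).
pose A : R := (2 + K * om * 2 `^ p) * C.
have A0 : 0 < A.
  by rewrite mulr_gt0// ltr_wpDr// !mulr_ge0 ?powR_ge0// ltW.
exists (q^-1 * (A * (D + q))) => f mf fW fW0.
pose T := (\int[mu]_x (`|f x| `^ p * weight_plus V x)%:E)%E.
rewrite -/T -[(\int[_]_x _)%E]/(energy V p f).
(* Any real c is allowed as centre; taking a value of f makes the remaining integral the inner one
   of [chain]. *)
have center y : (T <= A%:E * (\int[mu]_(x in Q n) (`|f x - f y| `^ p)%:E + energy V p f))%E.
  apply: (le_trans (center_bound hV W1 p1 mf fW fW0 K0 (f y) KP omE)).
  rewrite /A EFinM -muleA; apply: lee_wpmul2l.
    by rewrite lee_fin addr_ge0// !mulr_ge0 ?powR_ge0// ltW.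
  apply: (le_trans (truncation_limit hV W1 p1 mf (f y) C0 (cube_measurable _ _) CP)).
  apply: lee_wpmul2l; first by rewrite lee_fin ltW.
  apply: leeD2r; apply: (ge0_subset_integral mu (cube_measurable _ _) (mQ n) _ _ subQ).
    apply: (measurable_funS measurableT (@subsetT _ _)); apply/measurable_EFinP.
    exact: (measurable_powR_dist p mf (measurable_cst (f y))).
  by move=> x _; rewrite lee_fin powR_ge0.
have T0 : (0 <= T)%E.
  apply: integral_ge0 => x _; rewrite lee_fin mulr_ge0 ?powR_ge0//.
  exact: le_trans (ltW (weight_gt0 V x)) (weight_plus_ge V x).
have E0 : (0 <= energy V p f)%E := energy_ge0 _ _ _.
have mg := measurable_int_powR p (mQ n) mf.
have g0 y : (0 <= \int[mu]_(x in Q n) (`|f x - f y| `^ p)%:E)%E := int_powR_ge0 _ _ _ _.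
have mg0 : measurable_fun (Q 0%N) (fun y => \int[mu]_(x in Q n) (`|f x - f y| `^ p)%:E)%E.
  exact: (measurable_funS measurableT (@subsetT _ _) mg).
have A0e : (0 <= A%:E)%E by rewrite lee_fin ltW.
(* Integrate [center] over y in [Q 0], of measure q: the left side does not depend on y and the
   right side becomes [chain n f] plus q times the energy. *)
have H : (T * q%:E <= A%:E * (D%:E * energy V p f + energy V p f * q%:E))%E.
  rewrite -qE -(integral_cst mu (mQ 0%N)).
  apply: (@le_trans _ _ (\int[mu]_(y in Q 0%N) (A%:E *
      (\int[mu]_(x in Q n) (`|f x - f y| `^ p)%:E + cst (energy V p f) y)))%E).
    apply: (ge0_le_integral _ (mQ 0%N)).
    - by move=> y _; exact: T0.
    - exact: measurable_cst.
    - apply: (emeasurable_funM (measurable_cst _)).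
      exact: (emeasurable_funD mg0 (measurable_cst _)).
    - by move=> y _; exact: center.
  have mD := emeasurable_funD mg0 (measurable_cst (energy V p f)).
  rewrite (ge0_integralZl mu (mQ 0%N) mD (fun y _ => adde_ge0 (g0 y) E0) A0e).
  apply: lee_wpmul2l; first exact: A0e.
  rewrite (ge0_integralD mu (mQ 0%N) (fun y _ => g0 y) mg0 (fun y _ => E0) (measurable_cst _)).
  rewrite (integral_cst mu (mQ 0%N)); apply: leeD2r; exact: DP.
have c0 : 0 < q^-1 * (A * (D + q)).
  by apply: mulr_gt0; [rewrite invr_gt0 | apply: mulr_gt0 => //; exact: addr_gt0].
move: H E0 T0; case: (energy V p f) => [e|_ _ _|//]; last by rewrite gt0_muley ?leey// lte_fin.
rewrite !(=^~ EFinM, =^~ EFinD).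
case: (T) => [t|+ _ _|//]; last by rewrite gt0_mulye ?lte_fin// leye_eq.
rewrite !(=^~ EFinM, lee_fin) => H _ _.
have -> : q^-1 * (A * (D + q)) * e = q^-1 * (A * (D * e + e * q)) by ring.
by rewrite ler_pdivlMl// mulrC.
Qed.
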